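(* Let $F$ be a distribution function with right end-point $x^*\in(-\infty,\infty]$ that is in the domain of attraction of the generalised Pareto distribution $H_\gamma$ and satisfies the second order von Mises-type condition (SO) stated in the context, with $\gamma>-1/2$, and let $A$ be the function appearing in that condition. For $t<x^*$ put $v=v(t)=1/(1-F(t))$, $s(t)=(1-F(t))/F'(t)$, and let $l_t$ be the density of $(X-t)/s(t)$ given $X>t$, where $X\sim F$. Then there exist constants $0<c<C<\infty$ and $t^*<x^*$ such that, for all $t\in[t^*,x^* )$, $$c\,|A(v)|\le \mathscr{H}(l_t,h_\gamma)\le C\,|A(v)| .$$
   Context: Hellinger distance: for probability densities $f,g$ on $\mathbb{R}$ (w.r.t. Lebesgue measure), $\mathscr{H}(f,g)=\left[\int(\sqrt{f(x)}-\sqrt{g(x)})^2\,dx\right]^{1/2}$. Standard generalised Pareto (GP) distribution: for $\gamma\in\mathbb{R}$, $H_\gamma(x)=1-(1+\gamma x)^{-1/\gamma}$ with density $h_\gamma(x)=(1+\gamma x)^{-(1/\gamma+1)}$ for $x\in\mathcal{S}_\gamma$, where $\mathcal{S}_\gamma=(0,\infty)$ if $\gamma\ge0$ and $\mathcal{S}_\gamma=(0,-1/\gamma)$ if $\gamma<0$; $h_\gamma=0$ outside $\mathcal{S}_\gamma$. For $\gamma=0$ expressions are read as limits ($h_0(x)=e^{-x}$). Domain of attraction: with $F_t(x)=\mathbb{P}(X-t\le x\mid X>t)$, $F$ is in the domain of attraction of $H_\gamma$ if there is a positive function $\tilde s$ with $\lim_{t\to x^*}F_t(\tilde s(t)x)=H_\gamma(x)$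 for all continuity points $x$ of $H_\gamma$. Condition (SO): $F$ is twice differentiable; with $Q(p)=F^{\leftarrow}(1-p)$, where $F^{\leftarrow}$ is the left-continuous inverse of $F$, and $U(v)=Q(1/v)$, the function $$A(v)=\frac{vU''(v)}{U'(v)}+1-\gamma$$ (defined for large $v$) is of constant sign near infinity and $|A(v)|$ is regularly varying as $v\to\infty$ with index $\rho\le0$. Explicitly, $l_t(x)=f_t(s(t)x)s(t)$, where $f_t$ is the density of $F_t$. *)

(* Defs.v *)
From HB Require Import structures.
From mathcomp Require Import all_boot all_order all_algebra.
From mathcomp Require Import all_classical all_reals all_analysis.
Set Implicit Arguments.
Unset Strict Implicit.
Unset Printing Implicit Defensive.
Import Order.TTheory GRing.Theory Num.Theory.
Import numFieldNormedType.Exports.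
Local Open Scope ring_scope.
Local Open Scope classical_set_scope.

(* The integral is extended-real valued, so that no junk value can arise from
   a divergent integral; for probability densities it is at most 2. *)
Definition hellinger (R : realType) (f g : R -> R) : \bar R :=
  sqrte (\int[lebesgue_measure]_x ((Num.sqrt (f x) - Num.sqrt (g x)) ^+ 2)%:E)%E.

Definition gpd_support (R : realType) (gamma : R) : set R :=
  if gamma < 0 then `]0, - gamma^-1[ else `]0, +oo[.

(* The two conditionals extend the formula, valid on the support, to the whole
   line; powR is not used at a nonpositive base. *)
Definition gpd_cdf (R : realType) (gamma x : R) : R :=
  if x <= 0 then 0
  else if x \in gpd_support gamma then
    1 - (if gamma == 0 then expR (- x)
         else (1 + gamma * x) `^ (- gamma^-1))
  else 1.

Definition gpd_density (R : realType) (gamma x : R) : R :=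
  if x \in gpd_support gamma then
    if gamma == 0 then expR (- x)
    else (1 + gamma * x) `^ (- (gamma^-1 + 1))
  else 0.

Definition twice_derivable (R : realType) (f : R -> R) (x : R) : Prop :=
  derivable f x 1 /\ derivable (derive1 f) x 1.

Definition regularly_varying (R : realType) (g : R -> R) (rho : R) : Prop :=
  (exists v0 : R, measurable_fun `[v0, +oo[ g /\ forall v, v0 <= v -> 0 < g v) /\
  forall x : R, 0 < x -> g (v * x) / g v @[v --> +oo] --> x `^ rho.

Section distribution_function.
Context (R : realType).
Implicit Types (F : R -> R) (gamma rho p v t x : R).

Definition right_endpoint F : \bar R :=
  ereal_sup [set x%:E | x in [set x | F x < 1]].

(* The filter of t --> e with t < e; the case -oo is never an end-point. *)
Definition endpoint_nbhs (e : \bar R) : set_system R :=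
  match e with
  | r%:E => r^'-
  | +oo => pinfty_nbhs R
  | -oo => ninfty_nbhs R
  end%E.

Definition left_inverse F p : R := inf [set x | p <= F x].

Definition tail_quantile F v : R := left_inverse F (1 - v^-1).

Definition second_order_fun F gamma v : R :=
  let U := tail_quantile F in v * derive1 (derive1 U) v / derive1 U v + 1 - gamma.

(* The second conjunct makes second_order_fun meaningful for large v, where
   otherwise derive1 and division by 0 would yield junk values. *)
Definition second_order_condition F gamma rho : Prop :=
  let U := tail_quantile F in
  let A := second_order_fun F gamma in
  [/\ forall x, twice_derivable F x,
      \forall v \near +oo, twice_derivable U v /\ derive1 U v != 0,
      (\forall v \near +oo, 0 < A v) \/ (\forall v \near +oo, A v < 0),
      rho <= 0
    & regularly_varying (fun v => `|A v|) rho].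

Definition scaling F t : R := (1 - F t) / derive1 F t.

End distribution_function.

Section random_variable.
Context d (T : measurableType d) (R : realType) (P : probability T R).
Implicit Types (X : {RV P >-> R}) (gamma t x : R).

Definition cond_prob (A B : set T) : R := fine (P (A `&` B)) / fine (P B).

Definition df X x : R := fine (cdf X x).

Definition excess_df X t x : R :=
  cond_prob [set w | X w - t <= x] [set w | t < X w].

(* The excess distribution lives on the positive half-line, and its
   distribution function has a kink at 0. *)
Definition excess_density X t x : R :=
  if 0 < x then derive1 (excess_df X t) x else 0.

Definition scaled_excess_density X t x : R :=
  let s := scaling (df X) t in excess_density X t (s * x) * s.

Definition in_gpd_domain X gamma : Prop :=
  let e := right_endpoint (df X) in
  exists2 s : R -> R,
    forall t, (t%:E < e)%E -> 0 < s t
  & forall x, {for x, continuous (gpd_cdf gamma)} ->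
      excess_df X t (s t * x) @[t --> endpoint_nbhs e] --> gpd_cdf gamma x.

End random_variable.

(* Main.v *)
Require Import Defs.
From HB Require Import structures.
From mathcomp Require Import all_boot all_order all_algebra.
From mathcomp Require Import all_classical all_reals all_analysis.
From mathcomp Require Import measurable_realfun.
From mathcomp Require Import ring lra.
Import Order.TTheory GRing.Theory Num.Theory.
Import numFieldNormedType.Exports.
Local Open Scope ring_scope.
Local Open Scope classical_set_scope.

(* Work in logarithmic time: u(y) = U(e^y) satisfies F(u(y)) = 1 - e^-y and
   u'(y) = exp(gamma y + phi(y)) with phi'(y) = A(e^y) =: alpha(y).  For
   t = u(y) one has s(t) = u'(y), and the excess x(tau) = (u(y + tau) - u(y)) / u'(y)
   has l_t-survival probability e^-tau and solves x' = exp(gamma tau + b(tau)),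
   where b(tau) = phi(y + tau) - phi(y); the generalised Pareto quantile q solves
   the same equation with b = 0.  Since q(tau + D) = q(tau) + e^(gamma tau) q(D),
   writing x(tau) = q(tau + D) turns the ratio of the square roots of the two
   densities at x(tau) into exp((b(tau) - (1 + gamma) D) / 2).

   Regular variation gives |alpha(y + r)| between constant multiples of
   |alpha(y)| for r in [0, 1] and at most K |alpha(y)| e^(delta r) for all r >= 0
   (Potter).  Put a = |alpha(y)|.  Up to e^-tau = a^2 the exponent above is
   O(a e^(kappa tau)) with kappa < 1/2, where gamma > -1/2 is used, and
   the integral of e^(2 kappa tau) e^-tau converges; beyond that point both
   laws have mass O(a^2).  For small tau, |b(tau)| is at least c a tau while
   D = O(a tau^2), which yields the lower bound.  That a tends to 0 is not
   part of condition (SO) when rho = 0; it follows from the domain of attraction,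
   which forces the ratio of consecutive increments of u to tend to e^gamma.

   The function A need not be locally integrable, so phi is handled by the mean
   value theorem only. *)

(** * Increments of a function whose translates are asymptotically linear *)

Lemma lebesgue_measure_shift (R : realType) (c : R) (A : set R) :
  measurable A -> lebesgue_measure [set x | A (x - c)] = lebesgue_measure A.
Proof.
move=> mA.
have mf : measurable_fun [set: R] (fun x : R => x - c).
  by apply: continuous_measurable_fun => x; apply: cvgD; [exact: cvg_id|exact: cvg_cst].
pose mu := pushforward (@lebesgue_measure R) (fun x : R => x - c : measurableTypeR R).
have muE B : mu B = lebesgue_measure [set x | B (x - c)] by [].
rewrite -muE; symmetry.
apply: (@lebesgue_measure_unique R mu) => //.
move=> X [[a b] _ <-].
transitivity (lebesgue_measure [set x : R | `]a, b]%classic (x - c)]); last by [].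
rewrite (_ : [set x : R | `]a, b]%classic (x - c)] = `]a + c, b + c]%classic); last first.
  by apply/seteqP; split => x /=; rewrite !in_itv/= ltrBrDr lerBlDr.
by rewrite !lebesgue_measure_itv/= !lte_fin ltrD2r -!EFinB opprD addrACA subrr addr0.
Qed.

(** Only the rank from which the bound holds depends on [h], not the bound itself. One threshold
    thus serves for all [h] in [0, 2], which lets sets of good [h] exhaust that interval. *)
Lemma cvg_increment_seq (R : realType) (f : R -> R) (rho : R) (y : nat -> R) :
  (forall h, f (s + h) - f s @[s --> +oo] --> rho * h) ->
  (forall n, n%:R <= y n) ->
  forall h, 0 <= h <= 2 -> \forall n \near \oo, `|f (y n + h) - f (y n)| <= 1 + 2 * `|rho|.
Proof.
move=> hf hy h /andP[h0 h2].
have /cvgrPdist_le /(_ 1 ltr01) [M [_ HM]] := hf h.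
near=> n.
have : M < y n.
  apply: lt_le_trans (hy n); near: n; exact: nbhs_infty_gtr.
move=> /HM /= H.
have -> : f (y n + h) - f (y n) = rho * h - (rho * h - (f (y n + h) - f (y n))) by ring.
apply: le_trans (ler_normB _ _) _; rewrite addrC lerD//.
rewrite normrM (ger0_norm h0) mulrC; exact: ler_wpM2r.
Unshelve. all: by end_near. Qed.

(* Two sets of increments of almost full measure in [0, 2], one of them
   translated by h n, must meet; a common point bounds f (y n + h n) - f (y n). *)
Lemma local_bounded_increments (R : realType) (f : R -> R) (rho y0 : R) :
  measurable_fun `[y0, +oo[ f ->
  (forall h, f (s + h) - f s @[s --> +oo] --> rho * h) ->
  exists K y1 : R, forall y h : R, y1 <= y -> 0 <= h <= 1 -> `|f (y + h) - f y| <= K.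
Proof.
move=> mf hf; apply: contrapT => nex.
pose M : R := 1 + 2 * `|rho|.
(* If no uniform bound exists, there are base points tending to infinity with increments above
   [2 * M]. The factor 2 is what the triangle inequality through one intermediate point will
   contradict. *)
have : forall n : nat, exists yh : R * R,
    [/\ y0 <= yh.1, n%:R <= yh.1, 0 <= yh.2 <= 1 & 2 * M < `|f (yh.1 + yh.2) - f yh.1|].
  move=> n; apply: contrapT => nyh; apply: nex.
  exists (2 * M), (Num.max y0 n%:R) => y h; rewrite ge_max => /andP[y0y ny] h01.
  by rewrite leNgt; apply/negP => lt; apply: nyh; exists (y, h).
move=> /choice[yh hyh].
pose y n := (yh n).1; pose h n := (yh n).2.
have y0y n : y0 <= y n by case: (hyh n).
have ny n : n%:R <= y n by case: (hyh n).
have h01 n : 0 <= h n <= 1 by case: (hyh n).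
have big n : 2 * M < `|f (y n + h n) - f (y n)| by case: (hyh n).
(* The sets [G z n] increase with [n] and, by [cvg_increment_seq], their union is all of [0, 2].
   Their measures therefore tend to 2 and eventually exceed 7/4. *)
pose G (z : nat -> R) (n : nat) : set (measurableTypeR R) :=
  [set k : R | `[0, 2]%classic k /\ forall m, (n <= m)%N -> `|f (z m + k) - f (z m)| <= M].
have key (z : nat -> R) : (forall n, y0 <= z n) -> (forall n, n%:R <= z n) ->
  (forall n, measurable (G z n)) /\
  \forall n \near \oo, ((7/4)%:E < lebesgue_measure (G z n))%E.
  move=> y0z nz; pose V := G z.
  have mV n : measurable (V n : set (measurableTypeR R)).
    rewrite (_ : V n = \bigcap_(m in [set m | (n <= m)%N])
        (`[0, 2]%classic `&` (fun k => `|f (z m + k) - f (z m)|) @^-1` `]-oo, M]%classic)).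
      apply: bigcap_measurable; first by exists n => /=.
      move=> m _.
      suff : measurable_fun (`[0, 2]%classic : set R) (fun k : R => `|f (z m + k) - f (z m)|) by apply.
      apply: measurableT_comp => //; apply: measurable_funB => //.
      apply: (measurable_comp (F := `[y0, +oo[%classic)) mf _ => //.
        move=> _ /= [k + <-]; rewrite !in_itv/= => /andP[k0 _].
        by rewrite andbT (le_trans (y0z m))// lerDl.
      by apply: measurable_funD => //; exact: measurable_id.
    apply/seteqP; split.
      move=> k [k02 H] m /= nm; split => //=; rewrite in_itv/=; exact: H.
    move=> k H; split; first by have [] := H n (leqnn n).
    by move=> m nm; have [_] := H m nm; rewrite /= in_itv.
  split => //.
  have : lebesgue_measure \o V @ \oo --> lebesgue_measure (\bigcup_n V n : set (measurableTypeR R)).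
    apply: nondecreasing_cvg_mu => //; first exact: bigcup_measurable.
    move=> n m nm; apply/subsetPset => k [k02 H]; split => // p mp.
    by apply: H; exact: leq_trans mp.
  have -> : \bigcup_n V n = `[0, 2]%classic.
    apply/seteqP; split => [k [n _ []]//|k k02].
    have /(cvg_increment_seq _ f rho z hf nz) : 0 <= k <= 2 by move: k02; rewrite /= in_itv.
    move=> [n _ H]; exists n => //; split => // m nm; exact: H.
  rewrite lebesgue_measure_itv/= lte_fin ltr0n/= oppr0 addr0 => cvg.
  have : \forall n \near \oo, ((7/4)%:E < (lebesgue_measure \o V) n)%E.
    have H : ereal_nbhs 2%:E (fun u : \bar R => (7/4)%:E < u)%E.
      by apply: open_ereal_gt'; rewrite lte_fin; lra.
    exact: (cvg _ H).
  exact.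
have [mV nV] := key y y0y ny.
have y0yh n : y0 <= y n + h n.
  by apply: le_trans (y0y n) _; rewrite lerDl; case/andP: (h01 n).
have nyh n : n%:R <= y n + h n.
  by apply: le_trans (ny n) _; rewrite lerDl; case/andP: (h01 n).
have [mW nW] := key _ y0yh nyh.
near \oo => n.
have Vbig : ((7/4)%:E < lebesgue_measure (G y n))%E by near: n.
pose z m := y m + h m.
have Wbig : ((7/4)%:E < lebesgue_measure (G z n))%E by near: n.
move: {mV mW} (mV n) (mW n : measurable (G z n)).
set V := G y n in Vbig *; set W := G z n in Wbig * => mV mW.
pose W' : set (measurableTypeR R) := [set x | W (x - h n)].
have mW' : measurable W'.
  have : measurable_fun [set: R] (fun x : R => x - h n).
    by apply: continuous_measurable_fun => x; apply: cvgD; [exact: cvg_id|exact: cvg_cst].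
  by move=> /(_ measurableT W mW); rewrite setTI.
have W'big : ((7/4)%:E < lebesgue_measure W')%E by rewrite lebesgue_measure_shift.
have sub : V `|` W' `<=` `[0, 3]%classic.
  case/andP: (h01 n) => h0 h1.
  move=> x [[]|[]] /=; rewrite !in_itv/= => /andP[a b] _; apply/andP; split; lra.
(* Since [h n <= 1], both sets lie in [0, 3]; disjoint, they would have total measure above 7/2 >
   3. *)
have [VW0|] := pselect (V `&` W' = set0).
  have : (lebesgue_measure (V `|` W') <= lebesgue_measure (`[0%R, 3%R]%classic : set (measurableTypeR R)))%E.
    by apply: le_measure; rewrite ?inE//; exact: measurableU.
  rewrite measureU// lebesgue_measure_itv/= lte_fin ltr0n/= oppr0 addr0.
  apply/negP; rewrite -ltNge.
  apply: lt_trans (lteD Vbig W'big); rewrite -EFinD lte_fin; lra.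
(* The point [y n + k] is reached from [y n] by a step [k] and from [y n + h n] by a step [k - h n],
   and each of these increments is at most [M]. *)
move=> /eqP/set0P[k [[_ Vk] [_ Wk]]].
have := big n; apply/negP; rewrite -leNgt.
have -> : f (y n + h n) - f (y n) = (f (y n + k) - f (y n)) - (f (y n + h n + (k - h n)) - f (y n + h n)).
  by rewrite (_ : y n + h n + (k - h n) = y n + k); ring.
rewrite mulr_natl mulr2n; apply: le_trans (ler_normB _ _) _.
by apply: lerD; [exact: Vk|exact: Wk].
Unshelve. all: by end_near. Qed.

(** Far out, a unit increment is below [rho + delta], hence below [delta] because [rho <= 0].
    Summing unit steps gives the linear term, and [K] pays for the remaining fraction of a step. *)
Lemma potter_increments (R : realType) (f : R -> R) (rho y0 : R) :
  measurable_fun `[y0, +oo[ f -> rho <= 0 ->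
  (forall h, f (s + h) - f s @[s --> +oo] --> rho * h) ->
  forall delta, 0 < delta ->
  exists K y1 : R, forall y h : R, y1 <= y -> 0 <= h -> f (y + h) - f y <= K + delta * h.
Proof.
move=> mf rho0 hf delta d0.
have [K [y1 HK]] := local_bounded_increments _ _ _ _ mf hf.
have /cvgrPdist_lt /(_ delta d0) [M [_ HM]] := hf 1.
exists K, (Num.max y1 (M + 1)) => y h; rewrite ge_max => /andP[y1y My] h0.
have step (n : nat) : f (y + n%:R) - f y <= delta * n%:R.
  elim: n => [|n IH]; first by rewrite addr0 subrr mulr0.
  have : M < y + n%:R by have := ler0n R n; lra.
  move=> /HM /=; rewrite mulr1 ltr_norml => /andP[H _].
  by rewrite -natr1 addrA; lra.
pose n := Num.truncn h.
have /andP[nh hn] : n%:R <= h < n.+1%:R by exact: Num.Theory.truncn_itv.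
have := HK (y + n%:R) (h - n%:R).
rewrite (_ : y + n%:R + (h - n%:R) = y + h); last by ring.
have := ler0n R n; have := step n; rewrite -natr1 in hn => H1 H2 H3.
have : `|f (y + h) - f (y + n%:R)| <= K by apply: H3; [lra|apply/andP; split; lra].
move=> /ler_normlP[_ H4].
have : delta * n%:R <= delta * h by rewrite ler_pM2l.
lra.
Qed.

(** * Continuity and the mean value theorem from pointwise derivatives *)

Lemma is_derive_continuous (R : realType) (f : R -> R) (x df : R) :
  is_derive x 1 f df -> {for x, continuous f}.
Proof. by case=> dfx _; apply/differentiable_continuous/derivable1_diffP. Qed.

Lemma MVT_is_derive (R : realType) (f df : R -> R) (a b : R) : a <= b ->
  (forall x, a <= x <= b -> is_derive x 1 f (df x)) ->
  exists2 c, a <= c <= b & f b - f a = df c * (b - a).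
Proof.
move=> ab fdf.
have [x /[!in_itv]/= /andP[ax xb]|x|c /[!in_itv]/= cab fab] := @MVT_segment R f df a b ab.
- by apply: fdf; rewrite !ltW.
- suff : {within `[a, b], continuous f} by exact.
  apply: derivable_within_continuous => z /[!in_itv]/= zab.
  by have [] := fdf z zab.
- by exists c.
Qed.

(** * The generalised Pareto law in logarithmic time *)

Section gpd_quantile.
Context {R : realType}.
Implicit Types gamma tau x : R.

(* The time scale is logarithmic: the quantile of order 1 - e^-tau. *)
Definition gpd_quantile gamma tau : R :=
  if gamma == 0 then tau else (expR (gamma * tau) - 1) / gamma.

Local Notation q := gpd_quantile.

Lemma gpd_quantile0 gamma : q gamma 0 = 0.
Proof. by rewrite /q mulr0 expR0 subrr mul0r if_same. Qed.

Lemma gpd_quantileK gamma tau : 1 + gamma * q gamma tau = expR (gamma * tau).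
Proof.
rewrite /q; case: eqVneq => [->|g0]; first by rewrite !mul0r addr0 expR0.
by field.
Qed.

Lemma gpd_quantileD gamma (a b : R) : q gamma (a + b) = q gamma a + expR (gamma * a) * q gamma b.
Proof.
rewrite /q; case: eqVneq => [->|g0]; first by rewrite mul0r expR0 mul1r.
by rewrite mulrDr expRD; field.
Qed.

Lemma is_derive_gpd_quantile gamma tau :
  is_derive tau 1 (q gamma) (expR (gamma * tau)).
Proof.
have [->|g0] := eqVneq gamma 0.
  rewrite mul0r expR0 (_ : q 0 = id); last by apply/funext => x; rewrite /q eqxx.
  exact: is_derive_id.
rewrite (_ : q gamma = (fun t => gamma^-1 * (expR (gamma * t) - 1))); last first.
  by apply/funext => t; rewrite /q (negbTE g0) mulrC.
have H : is_derive tau 1 (fun t => expR (gamma * t)) (expR (gamma * tau) * gamma).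
  apply: (@is_derive1_comp R expR (fun t => gamma * t)).
  by apply: is_derive_eq; rewrite scaler1.
apply: is_derive_eq; rewrite subr0 /GRing.scale/=; field.
exact: g0.
Qed.

Lemma gpd_quantile_gt0 gamma tau : 0 < tau -> 0 < q gamma tau.
Proof.
move=> t0; have [c _] := MVT_is_derive _ _ _ _ _ (ltW t0) (fun x _ => is_derive_gpd_quantile gamma x).
by rewrite gpd_quantile0 !subr0 => ->; rewrite mulr_gt0// expR_gt0.
Qed.

Lemma gpd_quantile_lt gamma (a b : R) : (q gamma a < q gamma b) = (a < b).
Proof.
have H c e : c < e -> q gamma c < q gamma e.
  move=> ce; rewrite -(subrK c e) addrC gpd_quantileD ltrDl.
  by rewrite mulr_gt0 ?expR_gt0// gpd_quantile_gt0// subr_gt0.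
have [/H//|ba] := ltP a b; apply/negbTE; rewrite -leNgt.
by move: ba; rewrite le_eqVlt => /predU1P[->//|/H/ltW].
Qed.

Lemma gpd_quantile_support gamma tau : 0 < tau -> gpd_support gamma (q gamma tau).
Proof.
move=> t0; have q0 := gpd_quantile_gt0 gamma _ t0; rewrite /gpd_support.
case: ifPn => g0; rewrite /= in_itv/= q0 ?andbT//=.
have := expR_gt0 (gamma * tau); rewrite -gpd_quantileK.
move=> H; rewrite -ltrN2 opprK -(ltr_nM2l g0) mulfV; last by rewrite lt_eqF.
by rewrite mulrN; lra.
Qed.

Lemma gpd_density_quantile gamma tau : 0 < tau ->
  gpd_density gamma (q gamma tau) = expR (- (1 + gamma) * tau).
Proof.
move=> t0; rewrite /gpd_density mem_set; last exact: gpd_quantile_support.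
rewrite gpd_quantileK; case: eqVneq => [->|g0].
  by rewrite addr0 mulN1r /q eqxx.
by rewrite /powR gt_eqF ?expR_gt0// expRK; congr expR; field.
Qed.

Lemma gpd_cdf_quantile gamma tau : 0 < tau ->
  gpd_cdf gamma (q gamma tau) = 1 - expR (- tau).
Proof.
move=> t0; rewrite /gpd_cdf leNgt gpd_quantile_gt0//= mem_set; last exact: gpd_quantile_support.
rewrite gpd_quantileK; case: eqVneq => [->|g0].
  by rewrite /q eqxx.
by rewrite /powR gt_eqF ?expR_gt0// expRK; congr (1 - expR _); field.
Qed.

Lemma open_gpd_support gamma : open (gpd_support gamma).
Proof. by rewrite /gpd_support; case: ifP => _; exact: interval_open. Qed.

(** The support is open, so near such a point the distribution function is given by its smooth
    formula. This supplies the continuity points at which the domain of attraction is used. *)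
Lemma continuous_gpd_cdf_quantile gamma tau : 0 < tau ->
  {for q gamma tau, continuous (gpd_cdf gamma)}.
Proof.
move=> t0; have qs := gpd_quantile_support gamma _ t0.
have nsup : \forall x \near q gamma tau, gpd_support gamma x.
  exact: open_nbhs_nbhs (conj (open_gpd_support _) qs).
have npos : \forall x \near q gamma tau, 0 < x.
  exact: lt_nbhsr (gpd_quantile_gt0 _ _ t0).
pose f x : R := 1 - (if gamma == 0 then expR (- x) else (1 + gamma * x) `^ (- gamma^-1)).
have fE : {near q gamma tau, f =1 gpd_cdf gamma}.
  by near=> x; rewrite /gpd_cdf leNgt (near npos)//= mem_set//; near: x.
have cf : {for q gamma tau, continuous f}.
  apply: cvgB; first exact: cvg_cst.
  case: eqVneq => [_|g0].
    by apply: continuous_comp; [exact: opp_continuous|exact: continuous_expR].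
  apply: (@continuous_comp _ _ _ (fun x : R => 1 + gamma * x) (fun x => x `^ (- gamma^-1))).
    by apply: cvgD; [exact: cvg_cst|apply: cvgM; [exact: cvg_cst|exact: cvg_id]].
  apply/differentiable_continuous/derivable1_diffP/derivable_powR.
  by rewrite gpd_quantileK in_itv/= expR_gt0.
rewrite /prop_for /continuous_at -(nbhs_singleton fE).
apply: cvg_trans cf; apply: near_eq_cvg; exact: fE.
Unshelve. all: by end_near. Qed.

(** With [|E| <= eta], the derivative of [q gamma] is at least 1/2 on [-2|E|, 2|E|], so the values
    at the two ends bracket [E] and the intermediate value theorem applies. The lemma converts a
    small deviation in space into a small shift in time. *)
Lemma gpd_quantile_inv gamma : exists2 eta, 0 < eta &
  forall E, `|E| <= eta -> exists2 D, q gamma D = E & `|D| <= 2 * `|E|.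
Proof.
have c0 : 0 < 4 * (`|gamma| + 1) by rewrite mulr_gt0// ltr_wpDl.
exists (4 * (`|gamma| + 1))^-1; first by rewrite invr_gt0.
move=> E; rewrite -[X in _ <= X]div1r ler_pdivlMr// => HE.
have half c : `|c| <= 2 * `|E| -> 2^-1 <= expR (gamma * c).
  move=> cE; apply: le_trans (expR_ge1Dx _).
  suff : `|gamma * c| <= 2^-1 by move=> /ler_normlP[]; lra.
  rewrite normrM; apply: (@le_trans _ _ (`|gamma| * (2 * `|E|))); first exact: ler_wpM2l.
  have := normr_ge0 E; nra.
have E0 := normr_ge0 E.
have [D /[!in_itv]/= /andP[D1 D2] qD] : exists2 c, c \in `[- (2 * `|E|), 2 * `|E|]%R & q gamma c = E.
  apply: IVT; first by lra.
    apply: continuous_subspaceT => x; exact: is_derive_continuous (is_derive_gpd_quantile _ _).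
  rewrite ge_min le_max.
  have [|c /andP[c1 c2]] := MVT_is_derive _ _ _ (- (2 * `|E|)) 0 _ (fun x _ => is_derive_gpd_quantile gamma x); first by lra.
  rewrite gpd_quantile0 => h1.
  have [|e /andP[e1 e2]] := MVT_is_derive _ _ _ 0 (2 * `|E|) _ (fun x _ => is_derive_gpd_quantile gamma x); first by lra.
  rewrite gpd_quantile0 => h2.
  have /half hc : `|c| <= 2 * `|E| by apply/ler_normlP; split; lra.
  have /half he : `|e| <= 2 * `|E| by apply/ler_normlP; split; lra.
  have [h3 h4] := ler_normlP _ _ (lexx `|E|).
  apply/andP; split; apply/orP; [left|right]; nra.
by exists D => //; apply/ler_normlP; split; lra.
Qed.

End gpd_quantile.

(** * Tail mass of the generalised Pareto density *)

Section gpd_tail.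
Context {R : realType}.
Implicit Types gamma tau x : R.
Local Notation q := gpd_quantile.
Local Notation mu := (@lebesgue_measure R).

(** The inverse of [gpd_quantile gamma] where 1 + gamma x > 0; on the support it is minus the
    logarithm of the survival function. *)
Definition gpd_log gamma x : R := if gamma == 0 then x else ln (1 + gamma * x) / gamma.

Lemma gpd_logK gamma x : 0 < 1 + gamma * x -> q gamma (gpd_log gamma x) = x.
Proof.
rewrite /q /gpd_log; case: eqVneq => // g0 x0.
by rewrite mulrCA mulfV// mulr1 lnK ?posrE//; field.
Qed.

Lemma gpd_quantileLK gamma tau : gpd_log gamma (q gamma tau) = tau.
Proof.
rewrite /gpd_log; case: eqVneq => [->|g0]; first by rewrite /q eqxx.
by rewrite gpd_quantileK expRK; field.
Qed.

Lemma is_derive_gpd_log gamma x : 0 < 1 + gamma * x ->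
  is_derive x 1 (gpd_log gamma) (1 + gamma * x)^-1.
Proof.
move=> x0; rewrite /gpd_log; case: eqVneq => [->|g0].
  by rewrite mul0r addr0 invr1; exact: is_derive_id.
have H : is_derive x 1 (fun t => ln (1 + gamma * t)) ((1 + gamma * x)^-1 * gamma).
  apply: (@is_derive1_comp R (@ln R) (fun t => 1 + gamma * t)).
    exact: is_derive1_ln.
  by apply: is_derive_eq; rewrite add0r scaler1 mul1r.
rewrite (_ : (fun t => ln (1 + gamma * t) / gamma) = (fun t => gamma^-1 * ln (1 + gamma * t))); last first.
  by apply/funext => t; rewrite mulrC.
apply: is_derive_eq; rewrite /GRing.scale/=; field.
by rewrite g0 gt_eqF.
Qed.

Lemma gpd_density_ge0 gamma x : 0 <= gpd_density gamma x.
Proof. by rewrite /gpd_density; case: ifP => // _; case: ifP => _; [exact: expR_ge0|exact: powR_ge0]. Qed.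

Lemma measurable_gpd_density gamma : measurable_fun [set: R] (gpd_density gamma).
Proof.
pose f x : R := if gamma == 0 then expR (- x) else (1 + gamma * x) `^ (- (gamma^-1 + 1)).
rewrite (_ : gpd_density gamma = f \_ (gpd_support gamma)); last by apply/funext => x; rewrite patchE /gpd_density; case: ifP.
apply/(measurable_restrictT _ _).1; first by rewrite /gpd_support; case: ifP => _; exact: measurable_itv.
apply: measurable_funTS; rewrite /f; case: eqVneq => _.
  by apply: measurableT_comp => //.
apply: (measurableT_comp (measurable_powR _)) => //.
by apply: measurable_funD => //; apply: measurable_funM => //.
Qed.

(** Written through [gpd_log], the density has the antiderivative [F], minus the survival function,
    which tends to 0 at infinity. *)
Lemma gpd_density_tail_ge0 gamma tau : 0 <= gamma -> 0 < tau ->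
  (\int[mu]_(x in `[q gamma tau, +oo[) (gpd_density gamma x)%:E = (expR (- tau))%:E)%E.
Proof.
move=> g0 t0; have q0 := gpd_quantile_gt0 gamma _ t0.
have pos x : q gamma tau <= x -> 0 < 1 + gamma * x by move=> qx; nra.
pose f x := expR (- (1 + gamma) * gpd_log gamma x).
pose F x := - expR (- gpd_log gamma x).
have dF x : q gamma tau <= x -> is_derive x 1 F (f x).
  move=> /pos x0; have dL := is_derive_gpd_log _ _ x0.
  have H : is_derive x 1 (fun t => expR (- gpd_log gamma t)) (expR (- gpd_log gamma x) * - (1 + gamma * x)^-1).
    by apply: (@is_derive1_comp R expR (fun t => - gpd_log gamma t)).
  rewrite /F /f; apply: is_derive_eq.
  rewrite mulrN opprK -[in X in X^-1](gpd_logK _ _ x0) gpd_quantileK -expRN -expRD.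
  by congr expR; ring.
have cf x : q gamma tau <= x -> {for x, continuous f}.
  move=> /pos x0; have cL := is_derive_continuous _ _ _ _ (is_derive_gpd_log _ _ x0).
  apply: (@continuous_comp _ _ _ (fun t => - (1 + gamma) * gpd_log gamma t)); last exact: continuous_expR.
  by apply: cvgM; [exact: cvg_cst|exact: cL].
have -> : (\int[mu]_(x in `[q gamma tau, +oo[) (gpd_density gamma x)%:E = \int[mu]_(x in `[q gamma tau, +oo[) (f x)%:E)%E.
  apply: eq_integral => x; rewrite inE/= in_itv/= andbT => qx; congr EFin.
  have x0 := pos _ qx; have L0 : 0 < gpd_log gamma x.
    by rewrite -(gpd_quantile_lt gamma) gpd_quantile0 gpd_logK// (lt_le_trans q0).
  by rewrite -{1}(gpd_logK _ _ x0) gpd_density_quantile.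
rewrite (@ge0_continuous_FTC2y R f F (q gamma tau) 0) /F.
- by rewrite sub0e -EFinN opprK gpd_quantileLK.
- by move=> x _; exact: expR_ge0.
- apply: continuous_in_subspaceT => x; rewrite inE/= in_itv/= andbT; exact: cf.
- apply/cvgrPdist_lt => e e0; near=> x.
  have x0 : 0 < 1 + gamma * x.
    by apply: pos; near: x; apply: nbhs_pinfty_ge; exact: num_real.
  rewrite sub0r opprK ger0_norm ?expR_ge0//.
  rewrite -[ltRHS]lnK ?posrE// ltr_expR ltrNl -(gpd_quantile_lt gamma) gpd_logK//.
  by near: x; apply: nbhs_pinfty_gt; exact: num_real.
- by move=> x /ltW/dF[].
- have := is_derive_continuous _ _ _ _ (dF _ (lexx _)); exact: cvg_at_right_filter.
- by move=> x; rewrite in_itv/= andbT => /ltW/dF[_ <-]; rewrite derive1E.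
Unshelve. all: by end_near. Qed.

(** For -1 < gamma < 0 the exponent -(1/gamma + 1) is nonnegative and the base decreases, so the
    density is nonincreasing up to the end of its bounded support. Its value at [q gamma tau] times
    the remaining length is a bound of the right order e^-tau. *)
Lemma gpd_density_tail_lt0 gamma tau : -1 < gamma -> gamma < 0 -> 0 < tau ->
  (\int[mu]_(x in `[q gamma tau, +oo[) (gpd_density gamma x)%:E <= (expR (- tau) / - gamma)%:E)%E.
Proof.
move=> g1 g0 t0; have q0 := gpd_quantile_gt0 gamma _ t0.
have -> : (\int[mu]_(x in `[q gamma tau, +oo[) (gpd_density gamma x)%:E =
    \int[mu]_(x in `[q gamma tau, (- gamma^-1)%R[) (gpd_density gamma x)%:E)%E.
  rewrite integral_mkcond [RHS]integral_mkcond; apply: eq_integral => x _; rewrite !patchE.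
  rewrite !mem_setE !in_itv/= andbT; have [qx|//] := leP (q gamma tau) x.
  have [//|xg] := ltP x (- gamma^-1).
  by rewrite /gpd_density memNset// /gpd_support g0/= in_itv/= => /andP[_]; rewrite ltNge xg.
apply: (@le_trans _ _ (\int[mu]_(x in `[q gamma tau, (- gamma^-1)%R[) (expR (- (1 + gamma) * tau))%:E)%E).
  apply: ge0_le_integral => //.
  - by move=> x _; rewrite lee_fin gpd_density_ge0.
  - apply/measurable_EFinP; apply: measurable_funTS; exact: measurable_gpd_density.
  - move=> x /=; rewrite in_itv/= => /andP[qx xg]; rewrite lee_fin -gpd_density_quantile//.
    have sx : gpd_support gamma x by rewrite /gpd_support g0/= in_itv/= xg (lt_le_trans q0).
    rewrite /gpd_density !mem_set//; last exact: gpd_quantile_support.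
    rewrite lt_eqF//.
    have gx : 0 <= 1 + gamma * x.
      by move: xg; rewrite -(ltr_nM2l g0) mulrN mulfV ?lt_eqF//; lra.
    apply: ge0_ler_powR; rewrite ?nnegrE//.
    + rewrite oppr_ge0 -lerBrDr sub0r -(ler_nM2l g0) mulfV ?lt_eqF//; lra.
    + by rewrite gpd_quantileK expR_ge0.
    + by rewrite lerD2l ler_nM2l.
rewrite integral_cst//= lebesgue_measure_itv/= lte_fin.
have -> : q gamma tau < - gamma^-1.
  by have := gpd_quantile_support gamma _ t0; rewrite /gpd_support g0/= in_itv/= => /andP[].
rewrite -EFinB -EFinM lee_fin.
have -> : - gamma^-1 - q gamma tau = expR (gamma * tau) / - gamma.
  by rewrite -gpd_quantileK; field; rewrite lt_eqF.
rewrite mulrA -expRD le_eqVlt; apply/orP; left; apply/eqP; congr (expR _ / _); ring.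
Qed.

Lemma gpd_density_tail gamma : - 1 < gamma -> exists2 K, 0 < K & forall tau, 0 < tau ->
  (\int[mu]_(x in `[q gamma tau, +oo[) (gpd_density gamma x)%:E <= (K * expR (- tau))%:E)%E.
Proof.
move=> g1; have [g0|g0] := ltP gamma 0.
  exists (- gamma)^-1; first by rewrite invr_gt0; lra.
  by move=> tau t0; rewrite mulrC gpd_density_tail_lt0.
by exists 1 => // tau t0; rewrite mul1r gpd_density_tail_ge0.
Qed.

End gpd_tail.

(** * The squared Hellinger integral along one excess curve *)

Section integral_bounds.
Context {R : realType}.
Local Notation mu := (@lebesgue_measure R).
Local Notation q := gpd_quantile.

Lemma integral_itvcc_is_derive (f F : R -> R) (a b : R) : a < b ->
  (forall z, a <= z <= b -> is_derive z 1 F (f z)) ->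
  (forall z, a <= z <= b -> {for z, continuous f}) ->
  (\int[mu]_(z in `[a, b]) (f z)%:E = (F b - F a)%:E)%E.
Proof.
move=> ab dF cf; rewrite EFinB; apply: continuous_FTC2 => //.
- by apply: continuous_in_subspaceT => z; rewrite inE/= in_itv/=; exact: cf.
- have cF z : a <= z <= b -> {for z, continuous F}.
    by move=> /dF; exact: is_derive_continuous.
  split.
  + by move=> z; rewrite in_itv/= => /andP[/ltW az /ltW zb]; have [] := dF z (introT andP (conj az zb)).
  + by apply: cvg_at_right_filter; apply: cF; rewrite lexx (ltW ab).
  + by apply: cvg_at_left_filter; apply: cF; rewrite lexx (ltW ab).
- move=> z; rewrite in_itv/= => /andP[/ltW az /ltW zb].
  by rewrite derive1E; have [_ ->] := dF z (introT andP (conj az zb)).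
Qed.

Lemma expRB1_bounds (th : R) : `|th| <= 1 ->
  expR (- 1) * `|th| <= `|expR th - 1| <= expR 1 * `|th|.
Proof.
move=> th1.
have [c c1 ->] : exists2 c : R, `|c| <= 1 & expR th - 1 = expR c * th.
  have [t0|/ltW t0] := leP 0 th.
    have [c /andP[c0 ct]] := MVT_is_derive _ _ _ _ _ t0 (fun z _ => is_derive_expR z).
    rewrite expR0 subr0 => ->; exists c => //; rewrite ger0_norm//.
    by apply: le_trans ct _; rewrite ger0_norm in th1.
  have [c /andP[c0 ct]] := MVT_is_derive _ _ _ _ _ t0 (fun z _ => is_derive_expR z).
  rewrite expR0 sub0r => H; exists c; last by lra.
  by rewrite ler0_norm// in th1; rewrite ler0_norm//; lra.
rewrite normrM (ger0_norm (expR_ge0 _)); have /ler_normlP[c2 c3] := c1.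
by apply/andP; split; apply: ler_wpM2r => //; rewrite ler_expR; lra.
Qed.

Context (gamma : R) (b x p l : R -> R).
Context (gamma_gtN1 : - 1 < gamma).
Context (x0 : x 0 = 0).
Context (dx : forall tau : R, 0 <= tau -> is_derive tau 1 x (expR (gamma * tau + b tau))).
Context (dp : forall z : R, is_derive z 1 p (- l z)).
Context (cl : continuous l).
Context (l_ge0 : forall z, 0 <= l z).
Context (px : forall tau : R, 0 <= tau -> p (x tau) = expR (- tau)).
Context (lx : forall tau : R, 0 <= tau -> l (x tau) = expR (- (1 + gamma) * tau - b tau)).
Context (p_cvg : p z @[z --> +oo] --> 0).

Let sqdist (z : R) := (Num.sqrt (l z) - Num.sqrt (gpd_density gamma z)) ^+ 2.

Lemma curve_lt (s t : R) : 0 <= s -> s < t -> x s < x t.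
Proof.
move=> s0 st; have [c /andP[sc ct] H] := MVT_is_derive _ x (fun t => expR (gamma * t + b t)) s t (ltW st)
  (fun z H => dx z (le_trans s0 (proj1 (andP H)))).
by rewrite -subr_gt0 H mulr_gt0 ?expR_gt0// subr_gt0.
Qed.

Lemma curve_gt0 (tau : R) : 0 < tau -> 0 < x tau.
Proof. by move=> t0; rewrite -x0; exact: curve_lt. Qed.

Lemma curve_surj (s t z : R) : 0 <= s -> s <= t -> x s <= z <= x t -> exists2 r, s <= r <= t & x r = z.
Proof.
move=> s0 st /andP[sz zt].
have [r /[!in_itv]/= rst xr] : exists2 r, r \in `[s, t]%R & x r = z.
  apply: IVT => //; last by rewrite ge_min sz le_max zt orbT.
  apply: derivable_within_continuous => r; rewrite in_itv/= => /andP[sr _].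
  by have [] := dx r (le_trans s0 sr).
by exists r.
Qed.

(* x solves the same differential equation as q up to the factor e^b. *)
Lemma curve_deviation (tau M : R) : 0 <= tau ->
  (forall r, 0 <= r <= tau -> expR (gamma * r) * `|expR (b r) - 1| <= M) ->
  `|x tau - q gamma tau| <= M * tau.
Proof.
move=> t0 HM.
have dxq z : 0 <= z <= tau ->
    is_derive z 1 (fun r => x r - q gamma r) (expR (gamma * z) * (expR (b z) - 1)).
  move=> /andP[z0 _]; have H1 := dx z z0; have H2 := is_derive_gpd_quantile gamma z.
  by apply: is_derive_eq; rewrite expRD; ring.
have [c c0t] := MVT_is_derive _ _ _ _ _ t0 dxq.
rewrite x0 gpd_quantile0 !subr0 => ->.
rewrite !normrM (ger0_norm (expR_ge0 _)) (ger0_norm t0) ler_wpM2r//; exact: HM.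
Qed.

(** Each density is an exponential at its own time, [tau] for [l] and [tau + D] for the Pareto
    density; their quotient at the common point is the square of [expR th]. *)
Lemma sqdistE (tau D : R) : 0 < tau -> x tau = q gamma (tau + D) ->
  sqdist (x tau) = l (x tau) * (expR ((b tau - (1 + gamma) * D) / 2) - 1) ^+ 2.
Proof.
move=> t0 xq; rewrite /sqdist; set th := _ / 2.
have tD : 0 < tau + D by rewrite -(gpd_quantile_lt gamma) gpd_quantile0 -xq curve_gt0.
have -> : gpd_density gamma (x tau) = l (x tau) * expR th ^+ 2.
  rewrite lx ?ltW// xq gpd_density_quantile// -expRM_natl -expRD; congr expR.
  by rewrite /th; field.
rewrite sqrtrM// sqrtr_sqr ger0_norm ?expR_ge0//.
rewrite -[X in _ = X * _]sqr_sqrtr//; ring.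
Qed.

(** By [gpd_quantileD], the shift [D] must solve q(D) = e^(-gamma tau) (x(tau) - q(tau)). The
    rescaled deviation, not the deviation itself, therefore has to be small. *)
Lemma curve_gpd_quantile (tau eta : R) : (forall E : R, `|E| <= eta -> exists2 D, q gamma D = E & `|D| <= 2 * `|E|) ->
  expR (- gamma * tau) * `|x tau - q gamma tau| <= eta ->
  exists2 D, x tau = q gamma (tau + D) & `|D| <= 2 * (expR (- gamma * tau) * `|x tau - q gamma tau|).
Proof.
move=> inv HE.
have [|D qD HD] := inv (expR (- gamma * tau) * (x tau - q gamma tau)).
  by rewrite normrM (ger0_norm (expR_ge0 _)).
exists D; last by move: HD; rewrite normrM (ger0_norm (expR_ge0 _)).
by rewrite gpd_quantileD qD mulrA -expRD mulNr subrr expR0 mul1r subrKC.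
Qed.

Lemma measurable_sqdist : measurable_fun [set: R] sqdist.
Proof.
apply: measurable_funX; apply: measurable_funB.
  by apply: continuous_measurable_fun => z; apply: continuous_comp; [exact: cl|exact: sqrt_continuous].
apply: measurableT_comp; last exact: measurable_gpd_density.
by apply: continuous_measurable_fun; exact: sqrt_continuous.
Qed.

Lemma sqdist_ge0 z : 0 <= sqdist z.
Proof. exact: sqr_ge0. Qed.

Lemma measurable_curve_density : measurable_fun [set: R] l.
Proof. exact: continuous_measurable_fun. Qed.

Lemma continuous_curve_survival : continuous p.
Proof. by move=> z; exact: is_derive_continuous (dp z). Qed.

Lemma curve_density_integral (s t : R) : 0 <= s -> s < t ->
  (\int[mu]_(z in `[x s, x t]) (l z)%:E = (expR (- s) - expR (- t))%:E)%E.
Proof.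
move=> s0 st.
have dNp (z : R) : x s <= z <= x t -> is_derive z 1 (fun z => - p z) (l z).
  by move=> _; have H := dp z; apply: is_derive_eq; rewrite opprK.
rewrite (integral_itvcc_is_derive _ _ _ _ (curve_lt _ _ s0 st) dNp); last by move=> z _; exact: cl.
by rewrite !px ?(le_trans s0 (ltW st))// opprK addrC.
Qed.

Lemma curve_density_tail (s : R) : 0 <= s -> (\int[mu]_(z in `[x s, +oo[) (l z)%:E = (expR (- s))%:E)%E.
Proof.
move=> s0.
have dNp (z : R) : is_derive z 1 (fun z => - p z) (l z).
  by have H := dp z; apply: is_derive_eq; rewrite opprK.
rewrite (@ge0_continuous_FTC2y R l (fun z => - p z) (x s) 0).
- by rewrite sub0e -EFinN opprK px.
- by move=> z _.
- by apply: continuous_subspaceT.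
- by rewrite -oppr0; apply: cvgN.
- by move=> z _; apply: derivableN; have [] := dp z.
- by apply: cvg_at_right_filter; apply: cvgN; exact: continuous_curve_survival.
- by move=> z _; rewrite derive1E; have [_ ->] := dNp z.
Qed.

(** Only the stretch from [x s] to [x t] is kept. There the integrand is at least (k/e)^2 times [l],
    and [l] has mass e^-s - e^-t on it. *)
Lemma sqdist_integral_lower (s t k : R) : 0 < s -> s < t -> 0 <= k ->
  (forall tau : R, s <= tau <= t -> exists2 D, x tau = q gamma (tau + D) &
     k <= `|(b tau - (1 + gamma) * D) / 2| <= 1) ->
  ((expR (- 2) * k ^+ 2 * (expR (- s) - expR (- t)))%:E <= \int[mu]_(z in `]0%R, +oo[) (sqdist z)%:E)%E.
Proof.
move=> s0 st k0 HD.
apply: (@le_trans _ _ (\int[mu]_(z in `[x s, x t]) (sqdist z)%:E)%E); last first.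
  apply: ge0_subset_integral => //.
  - by apply/measurable_EFinP; apply: measurable_funTS; exact: measurable_sqdist.
  - by move=> z _; rewrite lee_fin sqdist_ge0.
  - by apply: subset_itv; rewrite bnd_simp// curve_gt0.
rewrite EFinM -(curve_density_integral s t (ltW s0) st) -ge0_integralZl_EFin//; last 3 first.
- by move=> z _; rewrite lee_fin.
- by apply/measurable_EFinP; apply: measurable_funTS; exact: measurable_curve_density.
- by rewrite mulr_ge0 ?expR_ge0 ?sqr_ge0.
apply: ge0_le_integral => //.
- by move=> z _; rewrite -EFinM lee_fin mulr_ge0// mulr_ge0 ?expR_ge0 ?sqr_ge0.
- apply/measurable_EFinP; apply: measurable_funTS; apply: measurable_funM => //; exact: measurable_curve_density.
- by apply/measurable_EFinP; apply: measurable_funTS; exact: measurable_sqdist.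
move=> z; rewrite /= in_itv/= => /(curve_surj s t z (ltW s0) (ltW st))[r /[dup] /HD[D xD /andP[kth th1]] /andP[sr rt] <-].
rewrite -EFinM lee_fin (sqdistE r D) ?(lt_le_trans s0)// mulrC ler_wpM2l//.
have /andP[H _] := expRB1_bounds _ th1.
have -> : expR (-2) = expR (-1) ^+ 2 :> R by rewrite -expRM_natl; congr expR; ring.
rewrite -exprMn -[leRHS]real_normK ?num_real//.
rewrite ler_sqr ?nnegrE ?mulr_ge0 ?expR_ge0//; apply: le_trans H.
by rewrite ler_wpM2l ?expR_ge0.
Qed.

(** The half-line is cut at [x T], where the survival probability e^-T equals a^2. Before the cut
    the integrand is at most a constant times a^2 e^(2 kappa tau) [l]; after it the sum of the two
    densities is enough. The three terms of the constant come from the first part, the tail of [l]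
    and the tail of the Pareto density. *)
Lemma sqdist_integral_upper (T eta B kappa K : R) : 0 < T -> 0 <= kappa -> kappa < 2^-1 -> 0 <= B ->
  eta <= 2^-1 -> 0 <= K ->
  (forall E : R, `|E| <= eta -> exists2 D, q gamma D = E & `|D| <= 2 * `|E|) ->
  (forall tau : R, 0 < tau ->
    (\int[mu]_(z in `[q gamma tau, +oo[) (gpd_density gamma z)%:E <= (K * expR (- tau))%:E)%E) ->
  let a := expR (- T / 2) in
  let B' := B / 2 + (1 + gamma) * B in
  (forall tau : R, 0 <= tau <= T -> `|b tau| <= B * (a * expR (kappa * tau))) ->
  (forall tau : R, 0 <= tau <= T ->
     expR (- gamma * tau) * `|x tau - q gamma tau| <= B * (a * expR (kappa * tau))) ->
  B * expR (- (2^-1 - kappa) * T) <= eta -> B' * expR (- (2^-1 - kappa) * T) <= 1 ->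
  (\int[mu]_(z in `]0%R, +oo[) (sqdist z)%:E <=
     (((expR 1 * B') ^+ 2 / (1 - 2 * kappa) + 1 + expR 1 * K) * a ^+ 2)%:E)%E.
Proof.
move=> T0 k0 k12 B0 eta12 K0 inv tailK a B' Hb HE small small'.
have g1 : 0 < 1 + gamma by have := gamma_gtN1; lra.
have B'0 : 0 <= B' by rewrite addr_ge0 ?mulr_ge0 ?(ltW g1) ?invr_ge0.
(* The exponent 1/2 - kappa is positive, so up to [T] the product a e^(kappa tau) is largest at [T],
   where it is still small. *)
have ak (tau : R) : tau <= T -> a * expR (kappa * tau) <= expR (- (2^-1 - kappa) * T).
  by move=> tT; rewrite -expRD ler_expR; nra.
have HD (tau : R) : 0 < tau <= T -> exists2 D, x tau = q gamma (tau + D) &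
    `|D| <= 1 /\ `|(b tau - (1 + gamma) * D) / 2| <= B' * (a * expR (kappa * tau)).
  move=> /andP[t0 tT]; have t0T : 0 <= tau <= T by rewrite (ltW t0).
  have HEt := HE _ t0T; have Hbt := Hb _ t0T; have akt := ak _ tT.
  have le_eta : expR (- gamma * tau) * `|x tau - q gamma tau| <= eta.
    by apply: le_trans HEt (le_trans _ small); rewrite ler_wpM2l.
  have [D xD HD] := curve_gpd_quantile _ _ inv le_eta.
  exists D => //; split; first by lra.
  rewrite normrM [X in _ * X]ger0_norm ?invr_ge0// ler_pdivrMr//.
  apply: le_trans (ler_normB _ _) _; rewrite normrM (gtr0_norm g1).
  have : (1 + gamma) * `|D| <= (1 + gamma) * (2 * (B * (a * expR (kappa * tau)))).
    by rewrite ler_wpM2l ?(ltW g1)//; apply: le_trans HD _; rewrite ler_wpM2l.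
  by rewrite /B'; lra.
have TT : 0 < T <= T by rewrite T0 lexx.
have a2 : a ^+ 2 = expR (- T) by rewrite -expRM_natl; congr expR; field.
(* Since tau = - ln (p z) on the curve, this is e^(2 kappa tau) [l] as a function of the space
   variable. Its antiderivative is an explicit power of [p], so no change of variables in the
   integral is needed. *)
pose g (z : R) := l z * expR (- (2 * kappa) * ln (p z)).
have mg : measurable_fun [set: R] g.
  apply: measurable_funM; first exact: measurable_curve_density.
  apply: measurableT_comp => //; apply: measurable_funM => //.
  apply: measurableT_comp => //; apply: continuous_measurable_fun; exact: continuous_curve_survival.
have g0 (z : R) : 0 <= g z by rewrite mulr_ge0// expR_ge0.
have k12' : 0 < 1 - 2 * kappa by lra.
have p0 (z : R) : 0 <= z <= x T -> 0 < p z.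
  move=> z0T; have [|r /andP[r0 _] <-] := curve_surj 0 T z (lexx _) (ltW T0); first by rewrite x0.
  by rewrite px// expR_gt0.
have gint : (\int[mu]_(z in `[0%R, x T]) (g z)%:E <= ((1 - 2 * kappa)^-1)%:E)%E.
  pose G (z : R) := - (expR ((1 - 2 * kappa) * ln (p z)) / (1 - 2 * kappa)).
  have dG (z : R) : 0 <= z <= x T -> is_derive z 1 G (g z).
    move=> z0T; have pz := p0 _ z0T; have Hp := dp z.
    have Hln : is_derive z 1 (fun z => ln (p z)) ((p z)^-1 * - l z).
      by apply: (@is_derive1_comp R (@ln R) p); exact: is_derive1_ln.
    have Hexp : is_derive z 1 (fun z => expR ((1 - 2 * kappa) * ln (p z)))
        (expR ((1 - 2 * kappa) * ln (p z)) * ((1 - 2 * kappa) * ((p z)^-1 * - l z))).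
      by apply: (@is_derive1_comp R expR (fun z => (1 - 2 * kappa) * ln (p z))).
    rewrite (_ : G = (fun z => - (1 - 2 * kappa)^-1 * expR ((1 - 2 * kappa) * ln (p z)))); last first.
      by apply/funext => w; rewrite /G; ring.
    apply: is_derive_eq; rewrite /g /GRing.scale/=.
    have -> : expR ((1 - 2 * kappa) * ln (p z)) = p z * expR (- (2 * kappa) * ln (p z)).
      by rewrite -[X in _ = X * _]lnK ?posrE// -expRD; congr expR; ring.
    field.
    by rewrite !gt_eqF.
  rewrite (integral_itvcc_is_derive _ _ _ _ (curve_gt0 _ T0) dG).
    have p00 : p 0 = 1 by rewrite -{1}x0 px// oppr0 expR0.
    rewrite lee_fin /G p00 px ?(ltW T0)// ln1 mulr0 expR0 opprK.
    by rewrite div1r gerDr oppr_le0 mulr_ge0 ?expR_ge0 ?invr_ge0 ?ltW.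
  move=> z z0T; have pz := p0 _ z0T; apply: cvgM; first exact: cl.
  apply: (@continuous_comp _ _ _ (fun z => - (2 * kappa) * ln (p z))); last exact: continuous_expR.
  apply: cvgM; first exact: cvg_cst.
  apply: (@continuous_comp _ _ _ p); first exact: continuous_curve_survival.
  exact: continuous_ln.
have splitset : `]0 : R, +oo[%classic = `]0 : R, x T]%classic `|` `]x T, +oo[%classic.
  by apply: itv_bndbnd_setU; rewrite bnd_simp// ltW// curve_gt0.
rewrite splitset ge0_integral_setU//; last 3 first.
- by apply/measurable_EFinP; apply: measurable_funTS; exact: measurable_sqdist.
- by move=> z _; rewrite lee_fin sqdist_ge0.
- rewrite disj_set2E; apply/eqP; rewrite -subset0 => z [] /=; rewrite !in_itv/= andbT.
  by move=> /andP[_ zT]; rewrite ltNge zT.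
have mMg : measurable_fun [set: R] (EFin \o (fun z => (expR 1 * B' * a) ^+ 2 * g z)).
  by apply/measurable_EFinP; apply: measurable_funM.
rewrite -[X in (X * _)%:E]addrA mulrDl EFinD; apply: leeD.
  apply: (@le_trans _ _ (\int[mu]_(z in `[0%R, x T]) (((expR 1 * B' * a) ^+ 2)%:E * (g z)%:E))%E); last first.
    rewrite ge0_integralZl_EFin ?sqr_ge0//; last 2 first.
    - by move=> z _; rewrite lee_fin.
    - by apply/measurable_EFinP; apply: measurable_funTS; exact: mg.
    apply: le_trans (lee_wpmul2l _ gint) _; first by rewrite lee_fin sqr_ge0.
    rewrite -EFinM lee_fin le_eqVlt; apply/orP; left; apply/eqP. field.
    by rewrite gt_eqF.
  apply: (@le_trans _ _ (\int[mu]_(z in `]0%R, x T]) (((expR 1 * B' * a) ^+ 2)%:E * (g z)%:E))%E); last first.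
    apply: ge0_subset_integral => //.
    - exact: (measurable_funTS mMg).
    - by move=> z _; rewrite -EFinM lee_fin mulr_ge0 ?sqr_ge0.
    - by apply: subset_itvr; rewrite bnd_simp.
  apply: ge0_le_integral => //.
  - by move=> z _; rewrite lee_fin sqdist_ge0.
  - by apply/measurable_EFinP; apply: measurable_funTS; exact: measurable_sqdist.
  - exact: (measurable_funTS mMg).
  move=> z; rewrite /= in_itv/= => /andP[z0 zT].
  have [|r /andP[r0 rT] xr] := curve_surj 0 T z (lexx _) (ltW T0); first by rewrite x0 (ltW z0).
  have {}r0 : 0 < r by rewrite lt_neqAle r0 andbT; apply/eqP => r00; move: z0; rewrite -xr -r00 x0 ltxx.
  have [|D xD [D1 Hth]] := HD r; first by rewrite r0.
  rewrite -EFinM lee_fin -xr (sqdistE r D)// /g px ?(ltW r0)// expRK [leRHS]mulrCA ler_wpM2l//.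
  have th1 : `|(b r - (1 + gamma) * D) / 2| <= 1.
    by apply: le_trans Hth (le_trans _ small'); rewrite ler_wpM2l// ak.
  have /andP[_ H] := expRB1_bounds _ th1.
  have -> : expR (- (2 * kappa) * - r) = expR (kappa * r) ^+ 2 by rewrite -expRM_natl; congr expR; ring.
  rewrite -exprMn -[leLHS]real_normK ?num_real//.
  rewrite ler_sqr ?nnegrE ?mulr_ge0 ?expR_ge0//; apply: le_trans H _.
  by rewrite -!mulrA ler_wpM2l ?expR_ge0.
(* At the cut, [x T] is the Pareto quantile at time [T + D] with |D| <= 1, so the Pareto tail beyond
   it is at most e K a^2. *)
have [D xD [D1 _]] := HD _ TT.
apply: (@le_trans _ _ (\int[mu]_(z in `[x T, +oo[) ((l z)%:E + (gpd_density gamma z)%:E))%E).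
  apply: (@le_trans _ _ (\int[mu]_(z in `[x T, +oo[) (sqdist z)%:E)%E).
    apply: ge0_subset_integral => //.
    - by apply/measurable_EFinP; apply: measurable_funTS; exact: measurable_sqdist.
    - by move=> z _; rewrite lee_fin sqdist_ge0.
    - by apply: subset_itvr; rewrite bnd_simp.
  apply: ge0_le_integral => //.
  - by move=> z _; rewrite lee_fin sqdist_ge0.
  - by apply/measurable_EFinP; apply: measurable_funTS; exact: measurable_sqdist.
  - apply: emeasurable_funD; apply/measurable_EFinP; apply: measurable_funTS; [exact: measurable_curve_density|exact: measurable_gpd_density].
  move=> z _; rewrite -EFinD lee_fin /sqdist sqrrB !sqr_sqrtr ?gpd_density_ge0//.
  by rewrite -addrA addrCA gerDr oppr_le0 mulrn_wge0// mulr_ge0 ?sqrtr_ge0.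
rewrite ge0_integralD//; last 4 first.
- by move=> z _; rewrite lee_fin.
- by apply/measurable_EFinP; apply: measurable_funTS; exact: measurable_curve_density.
- by move=> z _; rewrite lee_fin gpd_density_ge0.
- by apply/measurable_EFinP; apply: measurable_funTS; exact: measurable_gpd_density.
rewrite mulrDl mul1r EFinD; apply: leeD; first by rewrite curve_density_tail ?a2// ltW.
rewrite xD; have TD : 0 < T + D.
  by rewrite -(gpd_quantile_lt gamma) gpd_quantile0 -xD curve_gt0.
apply: le_trans (tailK _ TD) _; rewrite lee_fin a2 [expR 1 * K]mulrC -mulrA ler_wpM2l// -expRD ler_expR.
by have /ler_normlP[] := D1; lra.
Qed.

End integral_bounds.

(* In logarithmic time tau, x runs through the excesses, p is their survival
   function, l their density, and b measures the deviation from the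
   generalised Pareto law, for which b = 0. *)
Record tail_curve (R : realType) (gamma : R) (b x p l : R -> R) : Prop := {
  tail_curve0 : x 0 = 0;
  tail_curve_derive : forall tau : R, 0 <= tau -> is_derive tau 1 x (expR (gamma * tau + b tau));
  tail_curve_survival : forall z : R, is_derive z 1 p (- l z);
  tail_curve_continuous : continuous l;
  tail_curve_ge0 : forall z : R, 0 <= l z;
  tail_curve_survivalE : forall tau : R, 0 <= tau -> p (x tau) = expR (- tau);
  tail_curve_densityE : forall tau : R, 0 <= tau -> l (x tau) = expR (- (1 + gamma) * tau - b tau);
  tail_curve_cvg : p z @[z --> +oo] --> 0 }.

Arguments tail_curve {R}.

(** * Bounds uniform over all tail curves *)

Section uniform_bounds.
Context {R : realType}.
Local Notation mu := (@lebesgue_measure R).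
Local Notation q := gpd_quantile.
Implicit Types (gamma : R) (b x p l : R -> R).

(** The order of the quantifiers matters: [delta] depends on [gamma] alone, because [B] will be the
    Potter constant that belongs to [delta]. *)
Lemma sqdist_upper gamma : - 2^-1 < gamma -> exists2 delta : R, 0 < delta &
  forall B : R, 0 <= B -> exists C a0 : R, [/\ 0 < C, 0 < a0 &
  forall b x p l, tail_curve gamma b x p l -> forall a : R, 0 < a <= a0 ->
  (forall tau : R, 0 <= tau -> `|b tau| <= B * a * tau * expR (delta * tau)) ->
  (\int[mu]_(z in `]0%R, +oo[) ((Num.sqrt (l z) - Num.sqrt (gpd_density gamma z)) ^+ 2)%:E
     <= (C * a ^+ 2)%:E)%E].
Proof.
move=> g12.
have gN1 : -1 < gamma by lra.
(* [m] is the rate lost when the deviation is multiplied by e^(-gamma tau). Since gamma + m >= 0,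
   the exponent gamma + m + 2 delta is nonnegative, and the bound on e^(gamma r) |e^(b r) - 1| may
   be taken at the end of [0, tau]. *)
pose m := Num.max 0 (- gamma).
have m0 : 0 <= m by rewrite le_max lexx.
have mg : 0 <= gamma + m by rewrite -lerBlDl sub0r le_max lexx orbT.
have m12 : m < 2^-1 by rewrite gt_max; apply/andP; split; lra.
pose delta := (2^-1 - m) / 6.
have d0 : 0 < delta by rewrite divr_gt0// subr_gt0.
exists delta => // B B0.
(* One [delta] is the growth allowed in [b]; the other two absorb the factor tau in the bound on [b]
   and the factor tau from [curve_deviation]. The division by 6 keeps the sum below 1/2. *)
pose kappa := m + 3 * delta.
have k0 : 0 <= kappa by rewrite /kappa; lra.
have k12 : kappa < 2^-1 by rewrite /kappa /delta; lra.
pose B1 := B / delta.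
have B10 : 0 <= B1 by rewrite mulr_ge0// invr_ge0 ltW.
pose B2 := B1 + expR 1 * B1 / delta.
have e0 := expR_gt0 (1 : R).
have B20 : 0 <= B2 by rewrite addr_ge0// !mulr_ge0 ?invr_ge0 ?(ltW e0) ?(ltW d0).
pose B' := B2 / 2 + (1 + gamma) * B2.
have B'0 : 0 <= B' by rewrite addr_ge0// mulr_ge0//; lra.
have [eta' eta'0 inv'] := gpd_quantile_inv gamma.
pose eta := Num.min eta' 2^-1.
have eta0 : 0 < eta by rewrite lt_min eta'0 invr_gt0/=.
have eta12 : eta <= 2^-1 by rewrite ge_min lexx orbT.
have inv (E : R) : `|E| <= eta -> exists2 D, q gamma D = E & `|D| <= 2 * `|E|.
  by move=> H; apply: inv'; apply: le_trans H _; rewrite ge_min lexx.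
have [K K0 tailK] := gpd_density_tail gamma gN1.
pose S := B2 + B' + 1.
have S1 : 1 <= S by rewrite lerDr addr_ge0.
have S0 : 0 < S by lra.
have c0 : 0 < 2^-1 - kappa by lra.
(* With e^-T = a^2, the small quantity e^(-(1/2 - kappa) T) is a^(2 (1/2 - kappa)); [a0] is the
   value of [a] at which it equals [eta / S]. *)
pose a0 := expR (ln (eta / S) / (2 * (2^-1 - kappa))).
have etaS : 0 < eta / S by rewrite divr_gt0.
have etaS1 : eta / S < 1 by rewrite ltr_pdivrMr// mul1r; lra.
have a01 : a0 < 1.
  by rewrite -expR0 ltr_expR pmulr_llt0 ?invr_gt0 ?mulr_gt0// ln_lt0// etaS etaS1.
exists ((expR 1 * B') ^+ 2 / (1 - 2 * kappa) + 1 + expR 1 * K), a0; split.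
- rewrite addr_gt0 ?mulr_gt0// ltr_wpDl// mulr_ge0 ?sqr_ge0// invr_ge0; lra.
- exact: expR_gt0.
move=> b x p l [x0 dx dp cl l0 px lx pcvg] a /andP[apos aa0] Hb.
pose T := - 2 * ln a.
have aT : a = expR (- T / 2) by rewrite (_ : - T / 2 = ln a) ?lnK ?posrE// /T; field.
have T0 : 0 < T by rewrite /T mulNr oppr_gt0 nmulr_llt0// ?ltr0n ln_lt0// apos (le_lt_trans aa0).
have small : expR (- (2^-1 - kappa) * T) <= eta / S.
  rewrite -[leRHS]lnK ?posrE// ler_expR.
  have : ln a <= ln (eta / S) / (2 * (2^-1 - kappa)).
    by rewrite -[leRHS]expRK ler_ln ?posrE ?expR_gt0.
  by rewrite ler_pdivlMr ?mulr_gt0// /T; lra.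
have smallS (z : R) : 0 <= z -> z <= S -> z * expR (- (2^-1 - kappa) * T) <= eta.
  move=> z0 zS; have : S * expR (- (2^-1 - kappa) * T) <= S * (eta / S) by rewrite ler_pM2l.
  have -> : S * (eta / S) = eta by rewrite mulrCA mulfV ?gt_eqF// mulr1.
  apply: le_trans.
  by rewrite ler_wpM2r// expR_ge0.
have small1 : B2 * expR (- (2^-1 - kappa) * T) <= eta by apply: smallS => //; rewrite /S; lra.
have small2 : B' * expR (- (2^-1 - kappa) * T) <= 1.
  by apply: le_trans (smallS _ _ _) _ => //; rewrite /S; lra.
have ak (tau : R) : tau <= T -> a * expR (kappa * tau) <= expR (- (2^-1 - kappa) * T).
  by move=> tT; rewrite {1}aT -expRD ler_expR; nra.
have lin (tau : R) : tau <= expR (delta * tau) / delta.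
  by rewrite ler_pdivlMr// mulrC; apply: le_trans (expR_ge1Dx _); rewrite lerDr.
have Hb2 (tau : R) : 0 <= tau -> `|b tau| <= B1 * a * expR (2 * delta * tau).
  move=> t0; apply: le_trans (Hb _ t0) _.
  have -> : expR (2 * delta * tau) = expR (delta * tau) * expR (delta * tau) by rewrite -expRD; congr expR; ring.
  rewrite [leRHS]mulrA ler_wpM2r ?expR_ge0//.
  rewrite (_ : B1 * a * expR (delta * tau) = B * a * (expR (delta * tau) / delta)); last by rewrite /B1; ring.
  by rewrite ler_wpM2l// mulr_ge0// ltW.
have HbB2 (tau : R) : 0 <= tau -> `|b tau| <= B2 * (a * expR (kappa * tau)).
  move=> t0; apply: le_trans (Hb2 _ t0) _; rewrite [leRHS]mulrA; apply: ler_pM.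
  - by rewrite mulr_ge0// ltW.
  - exact: expR_ge0.
  - by rewrite ler_wpM2r ?(ltW apos)// lerDl !mulr_ge0 ?invr_ge0 ?(ltW e0) ?(ltW d0).
  - by rewrite ler_expR ler_wpM2r// /kappa; lra.
have b1 (tau : R) : 0 <= tau <= T -> `|b tau| <= 1.
  move=> /andP[t0 tT]; apply: le_trans (HbB2 _ t0) _.
  apply: (@le_trans _ _ (B2 * expR (- (2^-1 - kappa) * T))); last by lra.
  by rewrite ler_wpM2l// ak.
rewrite aT; apply: (sqdist_integral_upper gamma b x p l gN1 x0 dx dp cl l0 px lx pcvg T eta B2 kappa K) => //.
- exact: ltW.
- by move=> tau /andP[t0 _]; rewrite -aT; exact: HbB2.
move=> tau /andP[t0 tT]; rewrite -aT.
have eBa : 0 <= expR 1 * (B1 * a) by rewrite mulr_ge0 ?(ltW e0)// mulr_ge0// ltW.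
have dev : `|x tau - q gamma tau| <= expR 1 * (B1 * a) * expR ((gamma + m + 2 * delta) * tau) * tau.
  apply: curve_deviation => // r /andP[r0 rt].
  have br1 : `|b r| <= 1 by apply: b1; rewrite r0 (le_trans rt).
  have /andP[_ H] := expRB1_bounds _ br1.
  apply: (@le_trans _ _ (expR (gamma * r) * (expR 1 * (B1 * a * expR (2 * delta * r))))).
    rewrite ler_wpM2l ?expR_ge0//; apply: le_trans H _.
    by rewrite ler_wpM2l ?(ltW e0)// Hb2.
  have -> : expR (gamma * r) * (expR 1 * (B1 * a * expR (2 * delta * r))) =
      expR 1 * (B1 * a) * expR (gamma * r + 2 * delta * r) by rewrite expRD; ring.
  rewrite ler_wpM2l// ler_expR -mulrDl.
  apply: (@le_trans _ _ ((gamma + m + 2 * delta) * r)); first by rewrite ler_wpM2r//; lra.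
  by rewrite ler_wpM2l//; lra.
apply: (@le_trans _ _ (expR (- gamma * tau) * (expR 1 * (B1 * a) * expR ((gamma + m + 2 * delta) * tau) * (expR (delta * tau) / delta)))).
  rewrite ler_wpM2l ?expR_ge0//; apply: le_trans dev _.
  by rewrite ler_wpM2l// mulr_ge0// expR_ge0.
have -> : expR (- gamma * tau) * (expR 1 * (B1 * a) * expR ((gamma + m + 2 * delta) * tau) * (expR (delta * tau) / delta))
   = expR 1 * B1 / delta * (a * expR (kappa * tau)).
  have -> : kappa * tau = - gamma * tau + (gamma + m + 2 * delta) * tau + delta * tau by rewrite /kappa; ring.
  by rewrite !expRD; ring.
by rewrite ler_wpM2r ?mulr_ge0 ?expR_ge0 ?(ltW apos)// lerDr.
Qed.

Lemma sqdist_lower gamma (c1 c2 : R) : -1 < gamma -> 0 < c1 -> 0 < c2 ->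
  exists c a0 : R, [/\ 0 < c, 0 < a0 &
  forall b x p l, tail_curve gamma b x p l -> forall a : R, 0 < a <= a0 ->
  (forall tau : R, 0 <= tau <= 1 -> c1 * a * tau <= `|b tau| <= c2 * a * tau) ->
  ((c * a ^+ 2)%:E <=
  \int[mu]_(z in `]0%R, +oo[) ((Num.sqrt (l z) - Num.sqrt (gpd_density gamma z)) ^+ 2)%:E)%E].
Proof.
move=> gN1 c10 c20.
have g1 : 0 < 1 + gamma by lra.
have [eta' eta'0 inv'] := gpd_quantile_inv gamma.
pose eta := Num.min eta' 1.
have eta0 : 0 < eta by rewrite lt_min eta'0/=.
have eta1 : eta <= 1 by rewrite ge_min lexx orbT.
have inv (E : R) : `|E| <= eta -> exists2 D, q gamma D = E & `|D| <= 2 * `|E|.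
  by move=> H; apply: inv'; apply: le_trans H _; rewrite ge_min lexx.
have eg (r : R) : 0 <= r <= 1 -> expR (gamma * r) <= expR `|gamma| /\ expR (- gamma * r) <= expR `|gamma|.
  move=> /andP[r0 r1]; have [H1 H2] := ler_normlP _ _ (lexx `|gamma|).
  have H3 := normr_ge0 gamma.
  by rewrite !ler_expR; split; nra.
pose c3 := expR `|gamma| * (expR `|gamma| * (expR 1 * c2)).
have c30 : 0 < c3 by rewrite !mulr_gt0 ?expR_gt0.
(* Here (1 + gamma) |D| is at most 2 (1 + gamma) c3 a tau^2, and tau <= [tau1] makes this at most
   half of the lower bound c1 a tau on |b|. *)
pose tau1 := Num.min 1 (c1 / (4 * ((1 + gamma) * c3))).
have t10 : 0 < tau1 by rewrite lt_min ltr01/= divr_gt0// !mulr_gt0.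
have t11 : tau1 <= 1 by rewrite ge_min lexx.
have t1c : 4 * ((1 + gamma) * c3) * tau1 <= c1.
  by rewrite mulrC -ler_pdivlMr ?mulr_gt0// ge_min lexx orbT.
(* With S a <= eta <= 1, the deviation stays in the range of [gpd_quantile_inv] and both |b| and the
   half exponent stay below 1. *)
pose S := c2 + c3 + (1 + gamma) * c3.
have S0 : 0 < S by rewrite !addr_gt0 ?mulr_gt0.
(* The 8 collects three halves: the part of |b| left after [D], tau >= tau1 / 2, and the division by
   2 in the exponent. *)
pose ks := c1 * tau1 / 8.
exists (expR (- 2) * ks ^+ 2 * (expR (- (tau1 / 2)) - expR (- tau1))), (eta / S); split.
- rewrite !mulr_gt0 ?expR_gt0 ?exprn_gt0 ?divr_gt0 ?mulr_gt0// subr_gt0 ltr_expR; lra.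
- by rewrite divr_gt0.
move=> b x p l [x0 dx dp cl l0 px lx pcvg] a /andP[apos aa0] Hb.
have aS : S * a <= eta by rewrite mulrC -ler_pdivlMr.
have pos1 : 0 < (1 + gamma) * c3 by rewrite mulr_gt0.
have c2a : c2 * a <= eta by apply: le_trans aS; rewrite ler_pM2r// /S; lra.
have c3a : c3 * a <= eta by apply: le_trans aS; rewrite ler_pM2r// /S; lra.
have thS : (c2 + 2 * ((1 + gamma) * c3)) * a <= 2 * eta.
  have : (c2 + 2 * ((1 + gamma) * c3)) * a <= 2 * (S * a); last by lra.
  by rewrite [leRHS]mulrA ler_pM2r// /S; lra.
have -> : expR (- 2) * ks ^+ 2 * (expR (- (tau1 / 2)) - expR (- tau1)) * a ^+ 2
  = expR (- 2) * (ks * a) ^+ 2 * (expR (- (tau1 / 2)) - expR (- tau1)) by ring.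
apply: (sqdist_integral_lower gamma b x p l x0 dx dp cl l0 px lx).
- by rewrite divr_gt0.
- lra.
- by rewrite !mulr_ge0 ?(ltW apos) ?(ltW c10) ?(ltW t10).
move=> tau /andP[ht1 ht2].
have t0 : 0 < tau by lra.
have t1 : tau <= 1 by lra.
have t01 : 0 <= tau <= 1 by rewrite (ltW t0).
have dev : `|x tau - q gamma tau| <= expR `|gamma| * (expR 1 * (c2 * a * tau)) * tau.
  apply: curve_deviation => //; first exact: ltW.
  move=> r /andP[r0 rt]; have r01 : 0 <= r <= 1 by rewrite r0 (le_trans rt).
  have /andP[_ br] := Hb r r01.
  have brt : `|b r| <= c2 * a * tau by apply: le_trans br _; rewrite ler_wpM2l// mulr_ge0// ltW.
  have br1 : `|b r| <= 1.
    apply: le_trans brt _; have : c2 * a * tau <= c2 * a by rewrite ler_piMr// mulr_ge0// ltW.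
    by lra.
  have /andP[_ H] := expRB1_bounds _ br1.
  rewrite ler_pM ?expR_ge0//; first by case: (eg r r01).
  by apply: le_trans H _; rewrite ler_wpM2l ?expR_ge0.
have HE : expR (- gamma * tau) * `|x tau - q gamma tau| <= c3 * a * tau ^+ 2.
  apply: (@le_trans _ _ (expR `|gamma| * (expR `|gamma| * (expR 1 * (c2 * a * tau)) * tau))).
    by rewrite ler_pM ?expR_ge0//; case: (eg tau t01).
  by rewrite le_eqVlt; apply/orP; left; apply/eqP; rewrite /c3; ring.
have tau2 : tau ^+ 2 <= 1 by rewrite expr_le1// ltW.
have c3a0 : 0 <= c3 * a by rewrite ltW// mulr_gt0.
have c3at : c3 * a * tau ^+ 2 <= c3 * a by rewrite ler_piMr.
have [|D xD HD] := curve_gpd_quantile gamma x tau eta inv.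
  by apply: le_trans HE (le_trans c3at c3a).
exists D => //.
have {}HD : `|D| <= 2 * (c3 * a * tau ^+ 2) by lra.
have HgD : `|(1 + gamma) * D| <= 2 * ((1 + gamma) * c3) * a * tau ^+ 2.
  rewrite normrM (gtr0_norm g1); have : (1 + gamma) * `|D| <= (1 + gamma) * (2 * (c3 * a * tau ^+ 2)) by rewrite ler_pM2l.
  by lra.
have /andP[bl bu] := Hb tau t01.
have n2 : `|2^-1 : R| = 2^-1 by rewrite ger0_norm// invr_ge0.
rewrite normrM n2; apply/andP; split.
  rewrite ler_pdivlMr//; apply: le_trans (lerB_dist _ _).
  have at0 : 0 < a * tau by rewrite mulr_gt0.
  have : 2 * ((1 + gamma) * c3) * tau * (a * tau) <= c1 / 2 * (a * tau).
    rewrite ler_pM2r//; have : (1 + gamma) * c3 * tau <= (1 + gamma) * c3 * tau1 by rewrite ler_pM2l.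
    by lra.
  have : c1 / 2 * (a * (tau1 / 2)) <= c1 / 2 * (a * tau) by rewrite ler_pM2l ?divr_gt0// ler_pM2l.
  by rewrite /ks expr2 in HgD *; lra.
rewrite ler_pdivrMr//; apply: le_trans (ler_normB _ _) _.
have : c2 * a * tau <= c2 * a by rewrite ler_piMr// mulr_ge0// ltW.
have : 2 * ((1 + gamma) * c3) * a * tau ^+ 2 <= 2 * ((1 + gamma) * c3) * a.
  by rewrite ler_piMr// ltW// !mulr_gt0.
by lra.
Qed.

End uniform_bounds.

(** * The distribution function, its excesses and its tail quantile *)

Section distribution_facts.
Context {d : measure_display} {T : measurableType d} {R : realType} {P : probability T R}.
Context (X : {RV P >-> R}).
Local Notation F := (df X).
Context (F2 : forall x, twice_derivable F x).

Lemma df_cdf (x : R) : (F x)%:E = cdf X x.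
Proof. by rewrite /df fineK// fin_num_measure. Qed.

Lemma df_le (x y : R) : x <= y -> F x <= F y.
Proof. by move=> xy; rewrite -lee_fin !df_cdf cdf_nondecreasing. Qed.

Lemma df_cvgy : F z @[z --> +oo] --> (1 : R).
Proof. by have /fine_cvg := cvg_cdfy1 X. Qed.

Lemma df_cvgNy : F z @[z --> -oo] --> (0 : R).
Proof. by have /fine_cvg := cvg_cdfNy0 X. Qed.

Lemma is_derive_df (x : R) : is_derive x 1 F ((derive1 F) x).
Proof. by have [H _] := F2 x; rewrite derive1E; apply: derivableP. Qed.

Lemma continuous_df : continuous F.
Proof. by move=> x; exact: is_derive_continuous (is_derive_df x). Qed.

Lemma continuous_derive1_df : continuous (derive1 F).
Proof. by move=> x; apply/differentiable_continuous/derivable1_diffP; have [] := F2 x. Qed.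

Lemma derive1_df_ge0 (x : R) : 0 <= (derive1 F) x.
Proof.
rewrite leNgt; apply/negP => F'0.
have /cvgr_lt /(_ _ F'0) : (derive1 F) z @[z --> x] --> (derive1 F) x by exact: continuous_derive1_df.
move=> /nbhs_ballP[e /= e0 He].
have [|c /andP[xc ce] H] := MVT_is_derive R F (derive1 F) x (x + e / 2) _ (fun z _ => is_derive_df z).
  by rewrite lerDl divr_ge0// ltW.
have : (derive1 F) c < 0.
  apply: He; rewrite /ball/= ltr_distlC; apply/andP; split; lra.
have e2 : 0 < e / 2 by rewrite divr_gt0.
have xe : x <= x + e / 2 by rewrite lerDl ltW.
have := df_le x (x + e / 2) xe; rewrite -subr_ge0 H (_ : x + e / 2 - x = e / 2); last by ring.
by rewrite pmulr_lge0// => h1; rewrite ltNge h1.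
Qed.

Lemma prob_gt (t : R) : P [set w | t < X w] = (1 - F t)%:E.
Proof.
have -> : P [set w | t < X w] = ccdf X t.
  rewrite /ccdf /distribution /pushforward; congr (P _).
  by apply/seteqP; split => w /=; rewrite in_itv/= andbT.
by rewrite ccdf_1_cdf -df_cdf EFinB.
Qed.

Lemma prob_itv (t z : R) : 0 <= z -> P ([set w | X w - t <= z] `&` [set w | t < X w]) = (F (t + z) - F t)%:E.
Proof.
move=> z0.
have -> : P ([set w | X w - t <= z] `&` [set w | t < X w]) = distribution P X `]t, t + z].
  rewrite /distribution /pushforward; congr (P _).
  by apply/seteqP; split => w /=; rewrite in_itv/= lerBlDl; [move=> [-> ->]|move=> /andP[-> ->]].
rewrite EFinB !df_cdf /cdf.
have -> : `]-oo, t + z]%classic = `]-oo, t]%classic `|` `]t, t + z]%classic.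
  by apply: itv_bndbnd_setU => //; rewrite bnd_simp lerDl.
rewrite measureU//=.
  by rewrite addeAC subee ?add0e// fin_num_measure.
apply/seteqP; split => w //= []; rewrite !in_itv/= => wt /andP[tw _].
by move: tw; rewrite ltNge wt.
Qed.

Lemma excess_dfE (t z : R) : 0 <= z -> excess_df X t z = (F (t + z) - F t) / (1 - F t).
Proof. by move=> z0; rewrite /excess_df /cond_prob prob_itv// prob_gt. Qed.

Lemma excess_densityE (t z : R) : 0 < z -> excess_density X t z = (derive1 F) (t + z) / (1 - F t).
Proof.
move=> z0; rewrite /excess_density z0 derive1E.
have H := is_derive_df (t + z).
have H1 : is_derive z 1 (fun w => F (t + w)) (derive1 F (t + z) * 1).
  apply: (@is_derive1_comp R F (fun w => t + w)).
  by apply: is_derive_eq; rewrite add0r mulr1.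
have H2 : is_derive z 1 (fun w => (1 - F t)^-1 * (F (t + w) - F t)) (derive1 F (t + z) / (1 - F t)).
  by apply: is_derive_eq; rewrite subr0 mulr1 /GRing.scale/= mulrC.
have H3 : is_derive z 1 (excess_df X t) (derive1 F (t + z) / (1 - F t)).
  (* The formula of [excess_dfE] holds only on the nonnegative half-line, which contains a
     neighbourhood of [z] because [z] is positive. *)
  apply: near_eq_is_derive H2 => //.
  near=> w; rewrite excess_dfE; first by rewrite mulrC.
  by rewrite ltW//; near: w; exact: lt_nbhsr.
by case: H3.
Unshelve. all: by end_near. Qed.

Local Notation U := (tail_quantile F).

(** A continuous [F] attains every level in (0, 1), and [1 < v] places the level in that range; [F]
    at the infimum then takes exactly this level. *)
Lemma tail_quantileK (v : R) : 1 < v -> F (U v) = 1 - v^-1.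
Proof.
move=> v1; have v0 : 0 < v by lra.
pose p := 1 - v^-1.
have vi0 : 0 < v^-1 by rewrite invr_gt0.
have p0 : 0 < p by rewrite subr_gt0 invf_lt1.
have p1 : p < 1 by rewrite /p; lra.
have [x1 Fx1] : exists x1 : R, F x1 < p.
  have /cvgr_lt /(_ _ p0) [M [_ H]] := df_cvgNy.
  by exists (M - 1); apply: H; rewrite gtrBl.
have [x2 Fx2] : exists x2 : R, p < F x2.
  have /cvgr_gt /(_ _ p1) [M [_ H]] := df_cvgy.
  by exists (M + 1); apply: H; rewrite ltrDl.
have x12 : x1 <= x2.
  by rewrite leNgt; apply/negP => /ltW/df_le H; lra.
have [x _ Fx] : exists2 x, x \in `[x1, x2]%R & F x = p.
  apply: IVT => //; first by apply: continuous_subspaceT; exact: continuous_df.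
  by rewrite ge_min le_max (ltW Fx1) (ltW Fx2) orbT.
pose S := [set z : R | p <= F z].
have infS : has_inf S.
  split; first by exists x; rewrite /S/= Fx.
  exists x1 => z /= pz; rewrite leNgt; apply/negP => /ltW/df_le H.
  have {}pz : p <= F z by [].
  by lra.
apply/eqP; rewrite eq_le; apply/andP; split.
  rewrite -/p -Fx; apply: df_le; apply: ge_inf; first by case: infS.
  by rewrite /S/= Fx.
(* If [F] were below [p] at [U v], continuity would keep it below [p] slightly to the right, and the
   infimum would be larger. *)
rewrite leNgt; apply/negP => FUp.
have /cvgr_lt /(_ _ FUp) : F z @[z --> U v] --> F (U v) by exact: continuous_df.
move=> /nbhs_ballP[e /= e0 He].
have Fe : F (U v + e / 2) < p.
  by apply: He; rewrite /ball/= ltr_distlC; apply/andP; split; lra.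
have : U v + e / 2 <= U v.
  apply: lb_le_inf; first by case: infS.
  move=> z /= pz; rewrite leNgt; apply/negP => /ltW/df_le H.
  have {}pz : p <= F z by [].
  by lra.
by lra.
Qed.

Lemma tail_quantile_exp (y : R) : 0 < y -> F (U (expR y)) = 1 - expR (- y).
Proof. by move=> y0; rewrite tail_quantileK ?expR_gt1// expRN. Qed.

Lemma right_endpoint_gt (t : R) : F t < 1 -> (t%:E < right_endpoint F)%E.
Proof.
move=> Ft.
have /cvgr_lt /(_ _ Ft) : F z @[z --> t] --> F t by exact: continuous_df.
move=> /nbhs_ballP[e /= e0 He].
have Fe : F (t + e / 2) < 1.
  by apply: He; rewrite /ball/= ltr_distlC; apply/andP; split; lra.
apply: (@lt_le_trans _ _ (t + e / 2)%:E); first by rewrite lte_fin; lra.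
by apply: ereal_sup_ubound; exists (t + e / 2).
Qed.

Lemma df_lt1 (t : R) : (t%:E < right_endpoint F)%E -> F t < 1.
Proof.
move=> /ereal_sup_gt[_ [x Fx <-]]; rewrite lte_fin => tx.
exact: le_lt_trans (df_le _ _ (ltW tx)) Fx.
Qed.

(** This carries limits as t tends to the end-point over to limits as y tends to infinity. Finite
    and infinite end-points both reduce to a threshold [t0] with [F t0 < 1], which [F (U (expR y))]
    eventually exceeds. *)
Lemma endpoint_nbhs_tail_quantile (Q : set R) : endpoint_nbhs (right_endpoint F) Q ->
  \forall y \near +oo, Q (U (expR y)).
Proof.
move=> HQ.
have [t0 Ft0 Ht0] : exists2 t0 : R, F t0 < 1 & forall t : R, t0 < t -> F t < 1 -> Q t.
  have [xm Fxm] : exists x : R, F x < 1.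
    have /cvgr_lt /(_ _ ltr01) [M [_ H]] := df_cvgNy.
    by exists (M - 1); apply: H; rewrite gtrBl.
  have := right_endpoint_gt _ Fxm.
  move: HQ; case E : (right_endpoint F) => [r| |] //= HQ xr.
    have : \forall t \near r^'-, Q t by [].
    move=> /nbhs_ballP[e /= e0 He]; exists (r - e / 2).
      by apply: df_lt1; rewrite E lte_fin; lra.
    move=> t rt /right_endpoint_gt; rewrite E lte_fin => tr.
    by apply: He => //; rewrite /ball/= ltr_distlC; apply/andP; split; lra.
  case: HQ => M [_ HM]; exists M; first by apply: df_lt1; rewrite E ltry.
  by move=> t Mt _; exact: HM.
have lnt : 0 < 1 - F t0 by lra.
near=> y.
have y0 : 0 < y by near: y; apply: nbhs_pinfty_gt; exact: num_real.
have FU := tail_quantile_exp _ y0.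
have e0 := expR_gt0 (- y).
apply: Ht0; last by rewrite FU; lra.
rewrite ltNge; apply/negP => /df_le; rewrite FU.
suff : expR (- y) < 1 - F t0 by lra.
rewrite -[ltRHS]lnK ?posrE// ltr_expR ltrNl.
by near: y; apply: nbhs_pinfty_gt; exact: num_real.
Unshelve. all: by end_near. Qed.

End distribution_facts.

(** * Regular variation in logarithmic time and the vanishing of [alpha] *)

Section second_order.
Context {R : realType}.

Lemma cvg_expRy : expR y @[y --> +oo] --> (+oo_R : set_system R).
Proof.
apply/cvgryPge => M; near=> y; apply: le_trans (expR_ge1Dx y).
suff : M <= y by lra.
by near: y; apply: nbhs_pinfty_ge; exact: num_real.
Unshelve. all: by end_near. Qed.

(** Taking logarithms of both the argument and the value makes regular variation additive, which is
    the form needed by [local_bounded_increments] and [potter_increments]. *)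
Lemma regularly_varying_ln (g : R -> R) (rho : R) : regularly_varying g rho ->
  exists2 y0 : R, (forall y : R, y0 <= y -> 0 < g (expR y)) &
  measurable_fun `[y0, +oo[ (fun y => ln (g (expR y))) /\
  forall h, ln (g (expR (s + h))) - ln (g (expR s)) @[s --> +oo] --> rho * h.
Proof.
move=> [[v0 [mg gpos]] glim].
pose y0 := ln (Num.max v0 1).
have max0 : 0 < Num.max v0 1 by rewrite lt_max ltr01 orbT.
have ey (y : R) : y0 <= y -> v0 <= expR y.
  move=> y0y; apply: (@le_trans _ _ (expR y0)); last by rewrite ler_expR.
  by rewrite lnK ?posrE// le_max lexx.
exists y0; first by move=> y /ey; exact: gpos.
split.
  suff H : measurable_fun `[y0, +oo[ (fun y => g (expR y)).
    exact: (measurableT_comp (@measurable_ln R) H).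
  apply: (measurable_comp (F := `[v0, +oo[%classic)) mg _ => //.
  - by move=> _ /= [y + <-]; rewrite !in_itv/= !andbT; exact: ey.
  - by apply: measurable_funTS; exact: measurable_expR.
move=> h.
have H1 : g (expR s * expR h) / g (expR s) @[s --> +oo] --> expR h `^ rho.
  apply: (cvg_comp (expR) (fun v => g (v * expR h) / g v)).
    exact: cvg_expRy.
  exact/glim/expR_gt0.
have H2 : ln (g (expR s * expR h) / g (expR s)) @[s --> +oo] --> ln (expR h `^ rho).
  apply: (cvg_comp _ (@ln R) H1).
  by apply: continuous_ln; rewrite powR_gt0// expR_gt0.
rewrite (_ : rho * h = ln (expR h `^ rho)); last by rewrite -expRM expRK mulrC.
apply: cvg_trans H2; apply: near_eq_cvg; near=> s.
have sy : y0 <= s by near: s; apply: nbhs_pinfty_ge; exact: num_real.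
have shy : y0 <= s + h.
  by rewrite -lerBlDr; near: s; apply: nbhs_pinfty_ge; exact: num_real.
by rewrite -expRD ln_div// posrE gpos// ey.
Unshelve. all: by end_near. Qed.

Lemma regularly_varying_local (g : R -> R) (rho : R) : regularly_varying g rho ->
  exists K y1 : R, forall y h : R, y1 <= y -> 0 <= h <= 1 ->
  expR (- K) * g (expR y) <= g (expR (y + h)) <= expR K * g (expR y).
Proof.
move=> /regularly_varying_ln[y0 gpos [mf lim]].
have [K [y1 HK]] := local_bounded_increments _ _ _ _ mf lim.
exists K, (Num.max y0 y1) => y h; rewrite ge_max => /andP[y0y y1y] h01.
have g0 := gpos _ y0y.
have g1 : 0 < g (expR (y + h)).
  by case/andP: h01 => h0 _; apply: gpos; apply: le_trans y0y _; rewrite lerDl.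
have /ler_normlP[h1 h2] := HK y h y1y h01.
by apply/andP; split; rewrite -ler_ln ?posrE ?mulr_gt0 ?expR_gt0// lnM ?posrE ?expR_gt0// expRK; lra.
Qed.

Lemma regularly_varying_potter (g : R -> R) (rho : R) : regularly_varying g rho -> rho <= 0 ->
  forall delta : R, 0 < delta -> exists K y1 : R, forall y h : R, y1 <= y -> 0 <= h ->
  g (expR (y + h)) <= expR K * g (expR y) * expR (delta * h).
Proof.
move=> /regularly_varying_ln[y0 gpos [mf lim]] rho0 delta d0.
have [K [y1 HK]] := potter_increments _ _ _ _ mf rho0 lim _ d0.
exists K, (Num.max y0 y1) => y h; rewrite ge_max => /andP[y0y y1y] h0.
have g0 := gpos _ y0y.
have g1 : 0 < g (expR (y + h)) by apply: gpos; lra.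
have := HK y h y1y h0.
by rewrite -ler_ln ?posrE ?mulr_gt0 ?expR_gt0// !lnM ?posrE ?mulr_gt0 ?expR_gt0// !expRK; lra.
Qed.

(* By the mean value theorem the ratio of consecutive increments of u is
   exp (gamma + alpha d) for some d in [y, y + 2]. *)
Lemma cvg0_of_increment_ratio (gamma y0 K y1 : R) (u phi alpha : R -> R) :
  (forall y : R, y0 < y -> is_derive y 1 u (expR (gamma * y + phi y))) ->
  (forall y : R, y0 < y -> is_derive y 1 phi (alpha y)) ->
  (forall y h : R, y1 <= y -> 0 <= h <= 1 -> expR (- K) * `|alpha y| <= `|alpha (y + h)|) ->
  (u (y + 2) - u (y + 1)) / (u (y + 1) - u y) @[y --> +oo] --> expR gamma ->
  forall e : R, 0 < e -> \forall y \near +oo, `|alpha y| <= e.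
Proof.
move=> du dphi ctl lim e e0.
have limln : ln ((u (y + 2) - u (y + 1)) / (u (y + 1) - u y)) @[y --> +oo] --> gamma.
  rewrite -[X in _ --> X]expRK; apply: (cvg_comp _ (@ln R) lim).
  by apply: continuous_ln; exact: expR_gt0.
(* The mean value point is reached from [y] in two steps of length at most 1, and each step costs
   one factor e^-K. *)
have e'0 : 0 < e * expR (- K) * expR (- K) by rewrite !mulr_gt0 ?expR_gt0.
have /cvgrPdist_lt /(_ _ e'0) near_ln := limln.
near=> y.
have y0y : y0 < y by near: y; apply: nbhs_pinfty_gt; exact: num_real.
have y1y : y1 <= y by near: y; apply: nbhs_pinfty_ge; exact: num_real.
have rln : `|gamma - ln ((u (y + 2) - u (y + 1)) / (u (y + 1) - u y))| < e * expR (- K) * expR (- K).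
  by near: y; exact: near_ln.
pose r := (u (y + 2) - u (y + 1)) / (u (y + 1) - u y).
have [|c0 /andP[c00 _] uinc] := MVT_is_derive R u (fun z => expR (gamma * z + phi z)) y (y + 1) _
  (fun z H => du z (lt_le_trans y0y (proj1 (andP H)))); first by rewrite lerDl.
have upos : u (y + 1) - u y != 0.
  by rewrite uinc gt_eqF// mulr_gt0 ?expR_gt0//; lra.
(* This is Cauchy's mean value argument: by the choice of [r], the function u(z + 1) - r u(z) has
   the same value at [y] and [y + 1], so its derivative vanishes between them. *)
have dg (z : R) : y <= z <= y + 1 -> is_derive z 1 (fun z => u (z + 1) - r * u z)
    (expR (gamma * (z + 1) + phi (z + 1)) - r * expR (gamma * z + phi z)).
  move=> /andP[yz _].
  have H1 : is_derive z 1 (fun w => u (w + 1)) (expR (gamma * (z + 1) + phi (z + 1)) * 1).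
    apply: (@is_derive1_comp R u (fun w => w + 1)).
      by apply: du; lra.
    by apply: is_derive_eq; rewrite addr0.
  have H2 : is_derive z 1 u (expR (gamma * z + phi z)) by apply: du; lra.
  by apply: is_derive_eq; rewrite mulr1.
have [|c /andP[yc cy] Hc] := MVT_is_derive _ _ _ y (y + 1) _ dg; first by rewrite lerDl.
have {Hc} : expR (gamma * (c + 1) + phi (c + 1)) = r * expR (gamma * c + phi c).
  apply/eqP; rewrite -subr_eq0; apply/eqP.
  move: Hc; rewrite (_ : y + 1 - y = 1) ?mulr1; last by ring.
  move=> <-; rewrite (_ : y + 1 + 1 = y + 2); last by ring.
  by rewrite /r; field.
move=> Hr.
have {Hr} rE : r = expR (gamma + (phi (c + 1) - phi c)).
  rewrite (_ : gamma + _ = (gamma * (c + 1) + phi (c + 1)) - (gamma * c + phi c)); last by ring.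
  by rewrite expRB Hr mulfK// gt_eqF// expR_gt0.
have [|z /andP[cz zc] dphiE] := MVT_is_derive R phi alpha c (c + 1) _
  (fun z H => dphi z (lt_le_trans y0y (le_trans yc (proj1 (andP H))))); first by rewrite lerDl.
rewrite dphiE (_ : c + 1 - c = 1) ?mulr1 in rE; last by ring.
move: rln; rewrite -/r rE expRK opprD addrA subrr sub0r normrN => az.
have ac := ctl y (c - y) y1y.
have {}ac : expR (- K) * `|alpha y| <= `|alpha c|.
  by rewrite -[X in _ <= `|alpha X|](subrKC y c); apply: ac; apply/andP; split; lra.
have azc : expR (- K) * `|alpha c| <= `|alpha z|.
  rewrite -[X in _ <= `|alpha X|](subrKC c z); apply: ctl; first by lra.
  by apply/andP; split; lra.
have k0 := expR_gt0 (- K).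
rewrite -(ler_pM2r k0) -(ler_pM2r k0); apply: le_trans (ltW az).
apply: le_trans azc; rewrite mulrC ler_wpM2l ?(ltW k0)//.
by rewrite mulrC.
Unshelve. all: by end_near. Qed.

End second_order.

(** * The tail quantile in logarithmic time *)

Section log_tail_quantile.
Context {d : measure_display} {T : measurableType d} {R : realType} {P : probability T R}.
Context (X : {RV P >-> R}) (gamma : R).
Local Notation F := (df X).
Local Notation U := (tail_quantile F).
Local Notation u := (fun y : R => U (expR y)).
Context (F2 : forall x, twice_derivable F x).

Lemma log_tail_quantile_lt (y z : R) : 0 < y -> y < z -> u y < u z.
Proof.
move=> y0 yz; rewrite ltNge; apply/negP => /(df_le X).
rewrite !tail_quantile_exp//; last exact: lt_trans yz.
have : expR (- z) < expR (- y) by rewrite ltr_expR ltrN2.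
by lra.
Qed.

(** [phi] is ln u' - gamma y, whose derivative is 1 + v U''/U' - gamma at v = e^y. Differentiating
    F(u(y)) = 1 - e^-y gives the last identity. *)
Lemma log_tail_quantile_derive :
  (\forall v \near +oo, twice_derivable U v /\ derive1 U v != 0) ->
  exists (y0 : R) (phi : R -> R), [/\ 0 <= y0,
    forall y : R, y0 < y -> is_derive y 1 u (expR (gamma * y + phi y)),
    forall y : R, y0 < y -> is_derive y 1 phi (second_order_fun F gamma (expR y)) &
    forall y : R, y0 < y -> derive1 F (u y) * expR (gamma * y + phi y) = expR (- y)].
Proof.
move=> [M [_ HM]].
pose y0 := ln (Num.max M 1).
have max1 : 1 <= Num.max M 1 by rewrite le_max lexx orbT.
have max0 : 0 < Num.max M 1 by lra.
have y00 : 0 <= y0 by rewrite ln_ge0.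
have Mexp (y : R) : y0 < y -> M < expR y.
  move=> y0y; apply: (@le_lt_trans _ _ (expR y0)); last by rewrite ltr_expR.
  by rewrite lnK ?posrE// le_max lexx.
have du (y : R) : y0 < y -> is_derive y 1 u (derive1 U (expR y) * expR y).
  move=> /Mexp/HM[[dU _] _].
  apply: (@is_derive1_comp R U expR).
  by rewrite derive1E; apply: derivableP.
have dF (y : R) : y0 < y -> derive1 F (u y) * (derive1 U (expR y) * expR y) = expR (- y).
  move=> y0y; have H1 := is_derive_df X F2 (u y); have H2 := du _ y0y.
  have [_ <-] : is_derive y 1 (F \o u) (derive1 F (u y) * (derive1 U (expR y) * expR y)).
    exact: is_derive1_comp.
  have H3 : is_derive y 1 (fun z => 1 - expR (- z)) (expR (- y)).
    have H : is_derive y 1 (fun z : R => expR (- z)) (expR (- y) * - 1).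
      by apply: (@is_derive1_comp R expR (fun z => - z)); exact: is_deriveN.
    by apply: is_derive_eq; rewrite add0r mul1r mulrN1 opprK.
  have [_ //] : is_derive y 1 (F \o u) (expR (- y)).
  apply: near_eq_is_derive H3.
  near=> z; rewrite /= tail_quantile_exp//.
  apply: le_lt_trans y00 _; near: z; exact: lt_nbhsr.
(* The logarithm in [phi] requires U' > 0: as F' >= 0, a negative U' would make the positive product
   e^-y nonpositive. *)
have Upos (y : R) : y0 < y -> 0 < derive1 U (expR y).
  move=> y0y; have := expR_gt0 (- y); rewrite -dF// mulrA pmulr_lgt0 ?expR_gt0// => H.
  have [_ U0] := HM _ (Mexp _ y0y).
  rewrite lt_neqAle eq_sym U0/= leNgt; apply/negP => UN.
  by move: H; rewrite nmulr_lgt0// ltNge derive1_df_ge0.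
pose phi (y : R) := ln (expR y * derive1 U (expR y)) - gamma * y.
have phiE (y : R) : y0 < y -> expR (gamma * y + phi y) = derive1 U (expR y) * expR y.
  move=> /Upos Uy; rewrite /phi addrC subrK lnK ?posrE ?mulr_gt0 ?expR_gt0//.
  by rewrite mulrC.
exists y0, phi; split => //.
- by move=> y y0y; rewrite phiE//; exact: du.
- move=> y y0y; have Uy := Upos _ y0y; have [[_ dU'] _] := HM _ (Mexp _ y0y).
  have H1 : is_derive y 1 (fun z => derive1 U (expR z)) (derive1 (derive1 U) (expR y) * expR y).
    apply: (@is_derive1_comp R (derive1 U) expR).
    by rewrite [X in is_derive _ _ _ X]derive1E; apply: derivableP.
  have H2 : is_derive y 1 (fun z => expR z * derive1 U (expR z))
      (expR y * (derive1 (derive1 U) (expR y) * expR y) + derive1 U (expR y) * expR y).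
    by apply: is_derive_eq; rewrite /GRing.scale/=.
  have H3 : is_derive y 1 (fun z => ln (expR z * derive1 U (expR z)))
      ((expR y * derive1 U (expR y))^-1 * (expR y * (derive1 (derive1 U) (expR y) * expR y) + derive1 U (expR y) * expR y)).
    apply: (@is_derive1_comp R (@ln R) (fun z => expR z * derive1 U (expR z))).
    by apply: is_derive1_ln; rewrite mulr_gt0 ?expR_gt0.
  rewrite /phi; apply: is_derive_eq; rewrite /second_order_fun /GRing.scale/= mulr1.
  by field; rewrite !gt_eqF ?expR_gt0.
- by move=> y y0y; rewrite phiE// dF.
Unshelve. all: by end_near. Qed.

(** Convergence of distribution functions passes to quantiles. The excess law has value exactly 1 -
    e^-L at u(y + L) - u(y), so this increment is trapped between the scaled Pareto quantiles at L -
    eps and L + eps. *)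
Lemma increment_cvg_gpd_quantile (s : R -> R) (L : R) : 0 < L ->
  (forall t : R, (t%:E < right_endpoint F)%E -> 0 < s t) ->
  (forall x : R, {for x, continuous (gpd_cdf gamma)} ->
      excess_df X t (s t * x) @[t --> endpoint_nbhs (right_endpoint F)] --> gpd_cdf gamma x) ->
  (u (y + L) - u y) / s (u y) @[y --> +oo] --> gpd_quantile gamma L.
Proof.
move=> L0 s0 lim; apply/cvgrPdist_lt => e e0.
have cq : {for L, continuous (gpd_quantile gamma)}.
  exact: is_derive_continuous (is_derive_gpd_quantile gamma L).
have /cvgrPdist_lt/(_ _ e0) : gpd_quantile gamma z @[z --> L] --> gpd_quantile gamma L by exact: cq.
move=> /nbhs_ballP[r /= r0 Hr].
pose eps := Num.min r L / 2.
have minr0 : 0 < Num.min r L by rewrite lt_min r0.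
have minr : Num.min r L <= r by rewrite ge_min lexx.
have minL : Num.min r L <= L by rewrite ge_min lexx orbT.
have eps0 : 0 < eps by rewrite divr_gt0.
have epsL : 0 < L - eps by rewrite /eps; lra.
have q1 : `|gpd_quantile gamma L - gpd_quantile gamma (L - eps)| < e.
  by apply: Hr; rewrite /ball/= ltr_distlC; apply/andP; rewrite /eps; split; lra.
have q2 : `|gpd_quantile gamma L - gpd_quantile gamma (L + eps)| < e.
  by apply: Hr; rewrite /ball/= ltr_distlC; apply/andP; rewrite /eps; split; lra.
have Leps : 0 < L + eps by lra.
have lim1 := lim _ (continuous_gpd_cdf_quantile gamma _ epsL).
have lim2 := lim _ (continuous_gpd_cdf_quantile gamma _ Leps).
have /lim1/(endpoint_nbhs_tail_quantile X F2) near1 :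
    nbhs (gpd_cdf gamma (gpd_quantile gamma (L - eps))) [set w | w < 1 - expR (- L)].
  apply: lt_nbhsl; rewrite gpd_cdf_quantile// ltrD2l ltrN2 ltr_expR; lra.
have /lim2/(endpoint_nbhs_tail_quantile X F2) near2 :
    nbhs (gpd_cdf gamma (gpd_quantile gamma (L + eps))) [set w | 1 - expR (- L) < w].
  apply: lt_nbhsr; rewrite gpd_cdf_quantile// ltrD2l ltrN2 ltr_expR; lra.
near=> y.
have y0 : 0 < y by near: y; apply: nbhs_pinfty_gt; exact: num_real.
have yL : y < y + L by rewrite ltrDl.
have n1 : excess_df X (u y) (s (u y) * gpd_quantile gamma (L - eps)) < 1 - expR (- L) by near: y; exact: near1.
have n2 : 1 - expR (- L) < excess_df X (u y) (s (u y) * gpd_quantile gamma (L + eps)) by near: y; exact: near2.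
have Fy := tail_quantile_exp X F2 _ y0.
have FyL := tail_quantile_exp X F2 _ (lt_trans y0 yL).
have ey := expR_gt0 (- y).
have su : 0 < s (u y) by apply/s0/right_endpoint_gt => //; rewrite Fy gtrBl.
have D0 : 0 < u (y + L) - u y by rewrite subr_gt0 log_tail_quantile_lt.
have excD : excess_df X (u y) (u (y + L) - u y) = 1 - expR (- L).
  rewrite excess_dfE ?(ltW D0)// subrKC Fy FyL opprD expRD.
  have -> : 1 - (1 - expR (- y)) = expR (- y) by ring.
  by field; rewrite gt_eqF.
have mono (z w : R) : 0 <= z -> 0 <= w -> excess_df X (u y) z < excess_df X (u y) w -> z < w.
  move=> z0 w0; apply: contraTT; rewrite -!leNgt => wz.
  by rewrite !excess_dfE// ler_wpM2r ?invr_ge0 ?lerD2r ?df_le ?lerD2l// Fy subKr ltW.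
have l1 : s (u y) * gpd_quantile gamma (L - eps) < u (y + L) - u y.
  apply: mono; [|exact: ltW|by rewrite excD].
  by rewrite mulr_ge0 ?(ltW su)// ltW// gpd_quantile_gt0.
have l2 : u (y + L) - u y < s (u y) * gpd_quantile gamma (L + eps).
  apply: mono; [exact: ltW| |by rewrite excD].
  by rewrite mulr_ge0 ?(ltW su)// ltW// gpd_quantile_gt0.
have l1' : gpd_quantile gamma (L - eps) < (u (y + L) - u y) / s (u y) by rewrite ltr_pdivlMr// mulrC.
have l2' : (u (y + L) - u y) / s (u y) < gpd_quantile gamma (L + eps) by rewrite ltr_pdivrMr// mulrC.
rewrite ltr_norml; apply/andP; split.
  by move: q2 => /ltr_normlP[+ _]; clear -l2'; lra.
by move: q1 => /ltr_normlP[_ +]; clear -l1'; lra.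
Unshelve. all: by end_near. Qed.

(** Taking a quotient of increments cancels the unspecified normalising function [s]; the limit is
    (q(2) - q(1)) / q(1), which the addition rule evaluates. *)
Lemma increment_ratio_cvg : in_gpd_domain X gamma ->
  (u (y + 2) - u (y + 1)) / (u (y + 1) - u y) @[y --> +oo] --> expR gamma.
Proof.
move=> [s s0 lim].
have c1 := increment_cvg_gpd_quantile s 1 ltr01 s0 lim.
have c2 := increment_cvg_gpd_quantile s 2 (ltr0Sn R 1) s0 lim.
have q1 := gpd_quantile_gt0 gamma 1 ltr01.
have -> : expR gamma = (gpd_quantile gamma 2 - gpd_quantile gamma 1) / gpd_quantile gamma 1.
  rewrite (_ : 2 = 1 + 1 :> R)// gpd_quantileD mulr1; field.
  by rewrite gt_eqF.
have c3 : ((u (y + 2) - u y) / s (u y) - (u (y + 1) - u y) / s (u y)) / ((u (y + 1) - u y) / s (u y))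
    @[y --> +oo] --> (gpd_quantile gamma 2 - gpd_quantile gamma 1) / gpd_quantile gamma 1.
  by apply: cvgM; [exact: cvgB|apply: cvgV => //; rewrite gt_eqF].
apply: cvg_trans c3; apply: near_eq_cvg; near=> y.
have y0 : 0 < y by near: y; apply: nbhs_pinfty_gt; exact: num_real.
have y1 : y < y + 1 by rewrite ltrDl.
have Fy := tail_quantile_exp X F2 _ y0; have ey := expR_gt0 (- y).
have su : 0 < s (u y) by apply/s0/right_endpoint_gt => //; rewrite Fy gtrBl.
have D0 : 0 < u (y + 1) - u y by rewrite subr_gt0 log_tail_quantile_lt.
by rewrite -mulrBl opprB addrA subrK invfM invrK mulrACA mulVf ?mulr1// gt_eqF.
Unshelve. all: by end_near. Qed.

End log_tail_quantile.

(** * The Hellinger distance as an integral over a tail curve *)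

Section hellinger_bounds.
Context {d : measure_display} {T : measurableType d} {R : realType} {P : probability T R}.
Context (X : {RV P >-> R}) (gamma : R).
Local Notation F := (df X).
Local Notation U := (tail_quantile F).
Local Notation u := (fun y : R => U (expR y)).
Context (F2 : forall x, twice_derivable F x).

(** Both densities vanish on the nonpositive half-line; elsewhere the excess density is explicit. *)
Lemma hellinger_scaled_excess (t : R) : 0 < scaling F t ->
  hellinger (scaled_excess_density X t) (gpd_density gamma) =
  sqrte (\int[lebesgue_measure]_(z in `]0%R, +oo[)
    ((Num.sqrt (derive1 F (t + scaling F t * z) / (1 - F t) * scaling F t)
      - Num.sqrt (gpd_density gamma z)) ^+ 2)%:E)%E.
Proof.
move=> s0; rewrite /hellinger [in RHS]integral_mkcond; congr sqrte.
apply: eq_integral => z _; rewrite patchE mem_setE in_itv/= andbT.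
rewrite /scaled_excess_density /=; case: ifPn => [z0|].
  by rewrite excess_densityE// mulr_gt0.
rewrite -leNgt => z0.
rewrite /excess_density pmulr_rgt0// ltNge z0/= mul0r.
have -> : gpd_density gamma z = 0.
  rewrite /gpd_density memNset// /gpd_support.
  by case: ifP => _ /=; rewrite in_itv/= ltNge z0.
by rewrite subrr expr0n.
Qed.

Context (y0 : R) (phi : R -> R).
Context (y00 : 0 <= y0).
Context (du : forall y : R, y0 < y -> is_derive y 1 u (expR (gamma * y + phi y))).
Context (dF : forall y : R, y0 < y -> derive1 F (u y) * expR (gamma * y + phi y) = expR (- y)).

Lemma scaling_tail_quantile (y : R) : y0 < y -> scaling F (u y) = expR (gamma * y + phi y).
Proof.
move=> y0y; rewrite /scaling tail_quantile_exp//; last exact: le_lt_trans y0y.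
have F'0 : derive1 F (u y) != 0.
  by apply/eqP => F'0; have := expR_gt0 (- y); rewrite -dF// F'0 mul0r ltxx.
have -> : 1 - (1 - expR (- y)) = expR (- y) by ring.
by rewrite -dF// mulrAC mulfV// mul1r.
Qed.

(** Undoing the normalisation at time tau gives back u(y + tau), so survival and density on the
    curve follow from F(u) = 1 - e^-y and F'(u) u' = e^-y taken at y + tau. *)
Lemma tail_curve_tail_quantile (y : R) : y0 < y ->
  tail_curve gamma (fun tau => phi (y + tau) - phi y)
    (fun tau => (u (y + tau) - u y) / scaling F (u y))
    (fun z => (1 - F (u y + scaling F (u y) * z)) / (1 - F (u y)))
    (fun z => derive1 F (u y + scaling F (u y) * z) / (1 - F (u y)) * scaling F (u y)).
Proof.
move=> y0y; rewrite scaling_tail_quantile//; set s := expR (gamma * y + phi y).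
have s0 : 0 < s by exact: expR_gt0.
have yp : 0 < y by exact: le_lt_trans y0y.
have Fy : 1 - F (u y) = expR (- y) by rewrite tail_quantile_exp//; ring.
rewrite Fy.
have ey := expR_gt0 (- y).
have tauy (tau : R) : 0 <= tau -> y0 < y + tau by move=> ?; lra.
have back (tau : R) : u y + s * ((u (y + tau) - u y) / s) = u (y + tau).
  by field; rewrite gt_eqF.
split.
- by rewrite addr0 subrr mul0r.
- move=> tau /tauy yt; have H := du _ yt.
  have H1 : is_derive tau 1 (fun t => u (y + t)) (expR (gamma * (y + tau) + phi (y + tau)) * 1).
    apply: (@is_derive1_comp R u (fun t => y + t)).
    by apply: is_derive_eq; rewrite add0r mulr1.
  have H2 : is_derive tau 1 (fun t => s^-1 * (u (y + t) - u y))
     (expR (gamma * tau + (phi (y + tau) - phi y))).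
    apply: is_derive_eq; rewrite subr0 mulr1 /GRing.scale/= /s -expRN -expRD; congr expR; ring.
  by rewrite (_ : (fun tau => (u (y + tau) - u y) / s) = (fun t => s^-1 * (u (y + t) - u y)))//; apply/funext => t; rewrite mulrC.
- move=> z; have H := is_derive_df X F2 (u y + s * z).
  have H1 : is_derive z 1 (fun z => F (u y + s * z)) (derive1 F (u y + s * z) * s).
    apply: (@is_derive1_comp R F (fun z => u y + s * z)).
    by apply: is_derive_eq; rewrite add0r scaler1 mul1r.
  have H2 : is_derive z 1 (fun z => (expR (- y))^-1 * (1 - F (u y + s * z)))
     (- (derive1 F (u y + s * z) / expR (- y) * s)).
    by apply: is_derive_eq; rewrite /GRing.scale/=; ring.
  by rewrite (_ : (fun z => (1 - F (u y + s * z)) / expR (- y)) = (fun z => (expR (- y))^-1 * (1 - F (u y + s * z))))//; apply/funext => t; rewrite mulrC.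
- move=> z; apply: cvgM; last exact: cvg_cst.
  apply: cvgM; last exact: cvg_cst.
  apply: (@continuous_comp _ _ _ (fun z => u y + s * z)); last exact: continuous_derive1_df.
  by apply: cvgD; [exact: cvg_cst|apply: cvgM; [exact: cvg_cst|exact: cvg_id]].
- move=> z; rewrite mulr_ge0 ?(ltW s0)// mulr_ge0 ?invr_ge0 ?(ltW ey)//.
  exact: derive1_df_ge0.
- move=> tau t0; rewrite back tail_quantile_exp//; last by lra.
  by rewrite opprD addrA subrr add0r opprK -expRB; congr expR; ring.
- move=> tau t0; rewrite back.
  have /dF H := tauy _ t0.
  have -> : derive1 F (u (y + tau)) = expR (- (y + tau)) / expR (gamma * (y + tau) + phi (y + tau)).
    by rewrite -H mulfK// gt_eqF// expR_gt0.
  by rewrite /s -!expRB -expRD; congr expR; ring.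
- rewrite -(mul0r (expR (- y))^-1); apply: cvgM; last exact: cvg_cst.
  rewrite -[X in _ --> X](subrr 1); apply: cvgB; first exact: cvg_cst.
  apply: (cvg_comp (fun z => u y + s * z) F); last exact: df_cvgy.
  apply/cvgryPge => M; near=> z.
  by rewrite -lerBlDl mulrC -ler_pdivrMr.
Unshelve. all: by end_near. Qed.

(** A differentiable [u] has no jumps, so no late [t] is skipped and every statement in [t] may be
    read in [y]. *)
Lemma tail_quantile_surj (y1 t : R) : y0 < y1 -> u y1 <= t -> F t < 1 ->
  exists2 y, y1 <= y & u y = t.
Proof.
(* The second argument of the maximum forces e^-y2 < 1 - F t, which puts u(y2) beyond [t]. *)
move=> y01 ut Ft; pose y2 := Num.max y1 (1 - ln (1 - F t)).
have y12 : y1 <= y2 by rewrite le_max lexx.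
have y2p : 0 < y2 by apply: lt_le_trans y12; exact: le_lt_trans y01.
have ut2 : t <= u y2.
  rewrite leNgt; apply/negP => /ltW/(df_le X); rewrite tail_quantile_exp//.
  suff : expR (- y2) < 1 - F t by lra.
  rewrite -[ltRHS]lnK ?posrE ?subr_gt0// ltr_expR ltrNl.
  have : 1 - ln (1 - F t) <= y2 by rewrite le_max lexx orbT.
  by lra.
have [y /[!in_itv]/= /andP[y1y _] uy] : exists2 y, y \in `[y1, y2]%R & u y = t.
  apply: IVT => //; last by rewrite ge_min ut le_max ut2 orbT.
  apply: derivable_within_continuous => y; rewrite in_itv/= => /andP[y1y _].
  by have [] := du y (lt_le_trans y01 y1y).
by exists y.
Qed.

End hellinger_bounds.

(** * Two-sided bound on the Hellinger distance *)

Theorem proposition2p2 (d : measure_display) (T : measurableType d)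
    (R : realType) (P : probability T R) (X : {RV P >-> R}) (gamma rho : R)
    (hdom : in_gpd_domain X gamma)
    (hSO : second_order_condition (df X) gamma rho)
    (hgamma : - 2^-1 < gamma) :
  let F := df X in
  let xstar := right_endpoint F in
  let A := second_order_fun F gamma in
  let v := fun t : R => (1 - F t)^-1 in
  exists c C tstar : R,
    [/\ 0 < c, c < C, (tstar%:E < xstar)%E
      & forall t : R, tstar <= t -> (t%:E < xstar)%E ->
          ((c * `|A (v t)|)%:E
             <= hellinger (scaled_excess_density X t) (gpd_density gamma)
             <= (C * `|A (v t)|)%:E)%E].
Proof.
move=> F xstar A v.
case: hSO => F2 nearU _ rho0 rvA.
pose alpha (y : R) := A (expR y).
have [y0 [phi [y00 du dphi dF]]] := log_tail_quantile_derive X gamma F2 nearU.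
have [K [y1 loc]] := regularly_varying_local _ _ rvA.
have [yp apos _] := regularly_varying_ln _ _ rvA.
have [delta d0 upper] := sqdist_upper gamma hgamma.
have [K' [y2 pot]] := regularly_varying_potter _ _ rvA rho0 _ d0.
have gN1 : -1 < gamma by lra.
have [C [a0 [C0 a00 {}upper]]] := upper _ (expR_ge0 K').
have [c [a1 [c0 a10 lower]]] := sqdist_lower gamma (expR (- K)) (expR K) gN1 (expR_gt0 _) (expR_gt0 _).
have small : \forall y \near +oo, `|alpha y| <= Num.min a0 a1.
  apply: (cvg0_of_increment_ratio gamma y0 K y1 (fun y => tail_quantile F (expR y)) phi) => //.
  - by move=> y h y1y h01; case/andP: (loc y h y1y h01).
  - exact: increment_ratio_cvg.
  - by rewrite lt_min a00.
case: small => M [_ HM].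
pose ys := Num.max (Num.max (Num.max y0 y1) (Num.max y2 yp)) M + 1.
have ys0 : y0 < ys by rewrite ltr_pwDr// !le_max lexx.
have ys1 : y1 <= ys by rewrite ler_wpDr// !le_max lexx !orbT.
have ys2 : y2 <= ys by rewrite ler_wpDr// !le_max lexx !orbT.
have ysp : yp <= ys by rewrite ler_wpDr// !le_max lexx !orbT.
have ysM : M < ys by rewrite ltr_pwDr// !le_max lexx !orbT.
have ysgt0 : 0 < ys by exact: le_lt_trans ys0.
(* The integral bounds concern the squared distance, hence the square roots; adding [Num.sqrt c] to
   the upper constant makes the inequality between the constants strict. *)
exists (Num.sqrt c), (Num.sqrt c + Num.sqrt C), (tail_quantile F (expR ys)); split.
- by rewrite sqrtr_gt0.
- by rewrite ltrDl sqrtr_gt0.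
- by apply: right_endpoint_gt => //; rewrite tail_quantile_exp// gtrBl expR_gt0.
move=> t yst /(df_lt1 X) Ft.
have [y ysy <-{t yst Ft}] := tail_quantile_surj X gamma F2 y0 phi y00 du ys t ys0 yst Ft.
have y0y : y0 < y by exact: lt_le_trans ysy.
have ygt0 : 0 < y by exact: le_lt_trans y0y.
have -> : v (tail_quantile F (expR y)) = expR y.
  rewrite /v /F tail_quantile_exp// (_ : 1 - (1 - expR (- y)) = expR (- y)); last by ring.
  by rewrite -expRN opprK.
have a_gt0 : 0 < `|A (expR y)| by apply: apos; exact: le_trans ysy.
have := HM y (lt_le_trans ysM ysy); rewrite /= le_min /alpha => /andP[aa0 aa1].
have sE := scaling_tail_quantile X gamma F2 y0 phi y00 dF y y0y.
have curve := tail_curve_tail_quantile X gamma F2 y0 phi y00 du dF y y0y.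
rewrite hellinger_scaled_excess//; last by rewrite sE expR_gt0.
(* The value of [alpha] at a single intermediate time replaces its mean over [y, y + tau]; the
   Potter and local bounds hold at every such time. *)
have bMVT (tau : R) : 0 <= tau -> exists2 r, 0 <= r <= tau & phi (y + tau) - phi y = alpha (y + r) * tau.
  move=> t0; have [|r /andP[yr rt] H] := MVT_is_derive R phi alpha y (y + tau) _
    (fun z H => dphi z (lt_le_trans y0y (proj1 (andP H)))); first by rewrite lerDl.
  exists (r - y); first by rewrite subr_ge0 yr lerBlDl.
  by rewrite H subrKC; congr (_ * _); ring.
have bup (tau : R) : 0 <= tau ->
    `|phi (y + tau) - phi y| <= expR K' * `|A (expR y)| * tau * expR (delta * tau).
  move=> t0; have [r /andP[r0 rt] ->] := bMVT _ t0.
  rewrite normrM (ger0_norm t0) [leRHS]mulrAC; apply: ler_wpM2r => //.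
  apply: le_trans (pot y r _ r0) _; first exact: le_trans ysy.
  by rewrite ler_wpM2l ?mulr_ge0 ?expR_ge0// ler_expR ler_wpM2l// ltW.
have blo (tau : R) : 0 <= tau <= 1 ->
    expR (- K) * `|A (expR y)| * tau <= `|phi (y + tau) - phi y| <= expR K * `|A (expR y)| * tau.
  move=> /andP[t0 t1]; have [r /andP[r0 rt] ->] := bMVT _ t0.
  rewrite normrM (ger0_norm t0).
  have /andP[l1 l2] : expR (- K) * `|A (expR y)| <= `|alpha (y + r)| <= expR K * `|A (expR y)|.
    by apply: loc; [exact: le_trans ysy|rewrite r0 (le_trans rt)].
  by rewrite !ler_wpM2r.
have Hup := upper _ _ _ _ curve _ (introT andP (conj a_gt0 aa0)) bup.
have Hlo := lower _ _ _ _ curve _ (introT andP (conj a_gt0 aa1)) blo.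
have sqE (k : R) : 0 <= k -> (Num.sqrt k * `|A (expR y)|)%:E = sqrte (k * `|A (expR y)| ^+ 2)%:E.
  by move=> k0; rewrite /= sqrtrM// sqrtr_sqr normr_id.
apply/andP; split.
  rewrite sqE ?(ltW c0)// lee_sqrt//.
  by apply: integral_ge0 => z _; rewrite lee_fin sqr_ge0.
apply: (@le_trans _ _ (Num.sqrt C * `|A (expR y)|)%:E); last first.
  by rewrite lee_fin ler_wpM2r// lerDr sqrtr_ge0.
by rewrite sqE ?(ltW C0)// lee_sqrt// lee_fin mulr_ge0 ?sqr_ge0// ltW.
Qed.
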